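(* The values of $N(3,b)$ for $3\le b\le 12$ are $$N(3,3)=3,\quad N(3,4)=5,\quad N(3,5)=7,\quad N(3,6)=8,\quad N(3,7)=10,$$ $$N(3,8)=12,\quad N(3,9)=13,\quad N(3,10)=15,\quad N(3,11)=17,\quad N(3,12)=18.$$ Moreover, for every $b$ with $4\le b\le 12$ there is an irreducible polynomial $F\in\mathbb{C}[x,y]$ of bidegree $(3,b)$ whose zero curve in $\mathbb{A}^2(\mathbb{C})$ has a singularity of type $A_{N(3,b)}$.
   Context: Everything is over $\mathbb{C}$. Curves are effective divisors (not necessarily reduced). A nonzero polynomial $F\in\mathbb{C}[x,y]$ (or the curve $F=0$ in $\mathbb{A}^2(\mathbb{C})$) has bidegree $(a,b)$ if every monomial $x^iy^j$ occurring in $F$ has $(i,j)$ in the (closed) triangle with vertices $(a,0)$, $(0,0)$, $(0,b)$. A point $s$ of a curve $C$ on a smooth surface is a singularity of type $A_k$ ($k\ge 1$) if there are local analytic coordinates around $s$ in which $C$ is given by $y^2-x^{k+1}=0$; by convention a smooth point is of type $A_0$. $N(a,b)$ denotes the maximal integer $k\ge 0$ such that there exists a curve in $\mathbb{A}^2(\mathbb{C})$ of bidegree $(a,b)$ with a singularity of type $A_k$. *)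

(* Defs.v *)
From HB Require Import structures.
From mathcomp Require Import all_boot all_order all_algebra.
From mathcomp Require Export complex.
From mathcomp Require Import boolp classical_sets reals topology normedtype.

Set Implicit Arguments.
Unset Strict Implicit.
Unset Printing Implicit Defensive.

Import Order.TTheory GRing.Theory Num.Theory numFieldNormedType.Exports.
Local Open Scope classical_set_scope.
Local Open Scope ring_scope.

(* Bivariate polynomials are elements of {poly {poly K}}, with the convention
   of polyXY: F.[x, y] = F.[x%:P].[y], so x is the outer variable and F`_i`_j
   is the coefficient of x^i y^j.

   The definitions are over an arbitrary numFieldType K; they are intended for
   K = R[i] with R : realType.  There, as for every K, the norm takes its
   values in K, and 0 < r entails that r is real. *)

(* For a, b > 0 the first two inequalities follow from the third; they are
   needed only when the triangle degenerates to a segment or a point. *)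
Definition in_triangle (a b i j : nat) : bool :=
  [&& i <= a, j <= b & b * i + a * j <= a * b]%N.

Definition has_bidegree (K : numFieldType) (a b : nat) (F : {poly {poly K}})
    : Prop :=
  F != 0 /\ forall i j : nat, F`_i`_j != 0 -> in_triangle a b i j.

(* The double power series with coefficients c, centred at s, is absolutely
   convergent on some closed polydisc of positive radius r, and its sum on the
   open polydisc is f.  In particular c 0 0 = f s, and c 1 0 and c 0 1 are the
   partial derivatives of f at s. *)
Definition expands (K : numFieldType) (f : K * K -> K) (s : K * K)
    (c : nat -> nat -> K) : Prop :=
  exists r : K, [/\ 0 < r,
    exists M : K, forall n : nat,
      \sum_(i < n) \sum_(j < n) `|c i j| * r ^+ (i + j) <= M
    & forall x y : K, `|x| < r -> `|y| < r ->
      (fun n : nat => \sum_(i < n) \sum_(j < n) c i j * x ^+ i * y ^+ j)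
        @ \oo --> f (s.1 + x, s.2 + y)].

Definition analytic_at (K : numFieldType) (f : K * K -> K) (s : K * K)
    : Prop :=
  exists c : nat -> nat -> K, expands f s c.

(* (U, V) is a system of local analytic coordinates centred at s: analytic
   functions vanishing at s with nonzero Jacobian determinant at s. *)
Definition analytic_coordinates (K : numFieldType) (U V : K * K -> K)
    (s : K * K) : Prop :=
  exists u v : nat -> nat -> K,
    [/\ expands U s u, expands V s v, U s = 0, V s = 0
      & u 1%N 0%N * v 0%N 1%N - u 0%N 1%N * v 1%N 0%N != 0].

Definition smooth_point (K : numFieldType) (F : {poly {poly K}}) (s : K * K)
    : Prop :=
  F.[s.1, s.2] = 0 /\
  ((F^`()).[s.1, s.2] != 0 \/ (map_poly deriv F).[s.1, s.2] != 0).

(* For k > 0: near s, the divisor F = 0 is the divisor V^2 - U^(k+1) = 0, i.e.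
   the two functions agree up to an analytic factor E that is nonzero at s. *)
Definition type_A (K : numFieldType) (F : {poly {poly K}}) (s : K * K)
    (k : nat) : Prop :=
  if k is 0%N then smooth_point F s
  else exists U V E : K * K -> K,
    [/\ analytic_coordinates U V s, analytic_at E s, E s != 0
      & \forall z \near s,
          F.[z.1, z.2] = E z * (V z ^+ 2 - U z ^+ k.+1)].

Definition attains_A (K : numFieldType) (a b k : nat) : Prop :=
  exists2 F : {poly {poly K}}, has_bidegree a b F
    & exists s : K * K, type_A F s k.

(* "N(a, b) = n" *)
Definition N_is (K : numFieldType) (a b n : nat) : Prop :=
  attains_A K a b n /\ forall k : nat, attains_A K a b k -> (k <= n)%N.

Definition irreducible_elt (D : idomainType) (p : D) : Prop :=
  [/\ p != 0, p \isn't a GRing.unit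
    & forall q r : D, p = q * r ->
        q \is a GRing.unit \/ r \is a GRing.unit].

(* Main.v *)
(* Upper bound.  Near an A_k point, k > 3, write F = E (V^2 - U^(k+1)).  The curve
   V = 0 is transversal to the fibre of y, so a suitable x = xi(y) solves
   F(xi, y) = O(y^(k+1)) and F_x(xi, y) = O(y^k), whence the discriminant of F
   with respect to x has order exactly k + 1.  In terms of the seminvariants
   p, q of the cubic it is D = q^2 - 4 p^3 up to a constant, and
   D' p - 3 D p' = q (2 p q' - 3 p' q), so y^k divides the nonzero polynomial
   2 p q' - 3 p' q.  Its degree is at most deg p + deg q - 1 with
   deg p <= 2b/3 and deg q <= b, and the leading terms cancel when 3 divides b;
   in all cases k <= (5b - 4)/3.

   Lower bound.  For F = x^3 - 3 P x + 2 Q with Q^2 - P^3 = y^(k+1) D and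
   P(0), D(0) != 0, the double root at y = 0 is an A_k point: the simple root and
   the (k+1)-th root of a unit needed to write the normal form are power series,
   by an implicit function theorem.  Explicit P, Q exist over Q, Q(sqrt(-3)) for
   b = 8, and a cubic field for b = 11.  A root of F in C[y] would factor the
   discriminant in a way excluded by degrees, so F is irreducible. *)

Require Import Defs.
From Stdlib Require Import ZArith.
From mathcomp Require Import all_boot all_order all_algebra.
From mathcomp Require Import boolp classical_sets reals topology normedtype sequences.
From mathcomp Require Import ring zify ssrZ.

Set Implicit Arguments.
Unset Strict Implicit.
Unset Printing Implicit Defensive.

Import Order.TTheory GRing.Theory Num.Theory numFieldNormedType.Exports.
Local Open Scope classical_set_scope.
Local Open Scope ring_scope.

(** * Weighted l1 norms of polynomials *)

(** The passage from analytic to algebraic happens once: U, V and E are replaced by jets, and a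
    polynomial that is O(t^N) on small polydiscs has no term of total degree below N, so the normal
    form becomes a polynomial identity with a formal remainder. The restriction k > 3 is what
    excludes tangency of V = 0 with the fibre: tangency would force F(x, 0), of degree at most 3 in
    x, to vanish identically. Completeness enters only as convergence of absolutely convergent
    series. The explicit P and Q come from truncating P^(3/2) at degree b. With P(0) = 1 there are k
    - b equations for the floor(2 b / 3) other coefficients of P, weighted homogeneous under
    rescaling of y; for the values of k reached here and 3 not dividing b there is exactly one
    equation fewer than unknowns, so finitely many solutions are expected up to scaling, and their
    coefficients may generate a proper extension of the rationals. *)

Section PolyWeight.
Variable K : numDomainType.
Implicit Types (p q : {poly K}) (r x : K).

(** With absolute values taken coefficientwise, the weighted norm is an evaluation at [r], and its
    inequalities reduce to coefficientwise comparison. *)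
Definition abs_poly p : {poly K} := \poly_(i < size p) `|p`_i|.

Lemma coef_abs_poly p i : (abs_poly p)`_i = `|p`_i|.
Proof.
rewrite coef_poly; case: ltnP => // lepi.
by rewrite nth_default ?normr0.
Qed.

Definition weight r p : K := (abs_poly p).[r].

Lemma weightE r p n : (size p <= n)%N -> weight r p = \sum_(i < n) `|p`_i| * r ^+ i.
Proof.
move=> lepn; rewrite /weight (horner_coef_wide r (n := n)); last first.
  exact: leq_trans (size_poly _ _) lepn.
by apply: eq_bigr => i _; rewrite coef_abs_poly.
Qed.

Lemma le_horner_coef p q r : 0 <= r ->
  (forall i, p`_i <= q`_i) -> p.[r] <= q.[r].
Proof.
move=> r0 le_pq.
rewrite (horner_coef_wide r (leq_maxl (size p) (size q))).
rewrite (horner_coef_wide r (leq_maxr (size p) (size q))).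
by apply: ler_sum => i _; rewrite ler_wpM2r ?exprn_ge0.
Qed.

Lemma weight_ge0 r p : 0 <= r -> 0 <= weight r p.
Proof.
move=> r0; rewrite (weightE r (leqnn _)) sumr_ge0// => i _.
by rewrite mulr_ge0 ?exprn_ge0.
Qed.

Lemma weightD r p q : 0 <= r -> weight r (p + q) <= weight r p + weight r q.
Proof.
move=> r0; rewrite -hornerD; apply: le_horner_coef => // i.
by rewrite coefD !coef_abs_poly coefD ler_normD.
Qed.

Lemma weightN r p : weight r (- p) = weight r p.
Proof.
congr (_.[_]); apply/polyP => i.
by rewrite !coef_abs_poly coefN normrN.
Qed.

Lemma weightM r p q : 0 <= r -> weight r (p * q) <= weight r p * weight r q.
Proof.
move=> r0; rewrite -hornerM; apply: le_horner_coef => // i.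
rewrite coef_abs_poly !coefM; apply: le_trans (ler_norm_sum _ _ _) _.
by apply: ler_sum => j _; rewrite normrM !coef_abs_poly.
Qed.

Lemma weight0 r : weight r 0 = 0.
Proof. by rewrite (@weightE _ _ 0) ?size_poly0 ?big_ord0. Qed.

Lemma weight1 r : weight r 1 = 1.
Proof. by rewrite (@weightE _ _ 1) ?size_poly1 ?big_ord1 ?coef1/= ?normr1 ?mul1r. Qed.

Lemma weightX r p n : 0 <= r -> weight r (p ^+ n) <= weight r p ^+ n.
Proof.
move=> r0; elim: n => [|n IH]; first by rewrite !expr0 weight1.
rewrite !exprS; apply: le_trans (weightM _ _ r0) _.
by rewrite ler_wpM2l ?weight_ge0.
Qed.

Lemma weight_sum r (I : Type) (s : seq I) (P : pred I) (F : I -> {poly K}) :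
  0 <= r -> weight r (\sum_(i <- s | P i) F i) <= \sum_(i <- s | P i) weight r (F i).
Proof.
move=> r0; elim/big_rec2: _ => [|i y z _ le_zy]; first by rewrite weight0.
by apply: le_trans (weightD _ _ r0) _; rewrite lerD2l.
Qed.

Lemma le_weight r r' p : 0 <= r -> r <= r' -> weight r p <= weight r' p.
Proof.
move=> r0 le_r; rewrite !(weightE _ (leqnn _)); apply: ler_sum => i _.
by rewrite ler_wpM2l// lerXn2r// nnegrE (le_trans r0).
Qed.

Lemma weightMX r p n : weight r (p * 'X^n) = weight r p * r ^+ n.
Proof.
rewrite /weight -(hornerXn r n) -hornerM; congr (_.[_]).
apply/polyP => i; rewrite coef_abs_poly !coefMXn; case: ifP; rewrite ?normr0//.
by rewrite coef_abs_poly.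
Qed.

Lemma norm_horner_le r x p : `|x| <= r -> `|p.[x]| <= weight r p.
Proof.
move=> xr; have r0 := le_trans (normr_ge0 x) xr.
rewrite horner_coef (weightE r (leqnn _)); apply: le_trans (ler_norm_sum _ _ _) _.
by apply: ler_sum => i _; rewrite normrM normrX ler_wpM2l// lerXn2r// nnegrE.
Qed.

Lemma weight_take r p n : 0 <= r -> weight r (take_poly n p) <= weight r p.
Proof.
move=> r0; apply: le_horner_coef => // i.
by rewrite !coef_abs_poly coef_take_poly; case: ifP; rewrite ?normr0.
Qed.

End PolyWeight.

Lemma norm_horner_dvdXn (K : numFieldType) (r x : K) (n : nat) (p : {poly K}) :
  0 < r -> `|x| <= r -> 'X^n %| p -> `|p.[x]| <= weight r p * (`|x| / r) ^+ n.
Proof.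
move=> r0 xr /dvdpP[q ->]; rewrite weightMX hornerM hornerXn normrM normrX.
rewrite expr_div_n -mulrA; apply: ler_pM; rewrite ?exprn_ge0 ?norm_horner_le//.
by rewrite mulrCA mulfV ?mulr1// expf_neq0// gt_eqF.
Qed.

(** * Analytic solutions of polynomial equations *)

Lemma dvdp_horner_sub (R : idomainType) (P : {poly {poly R}}) (S T : {poly R}) :
  T - S %| P.[T] - P.[S].
Proof.
have /factor_theorem[Q] : root (P - P.[S]%:P) S by rewrite /root !hornerE subrr.
move=> /(congr1 (fun p => p.[T])); rewrite !hornerE => ->.
exact: dvdp_mull.
Qed.

(** Completeness of [K] in the only form used. Norms and bounds live in [K] itself, so the
    completeness of the reals enters only in the proof for [R[i]]. *)
Definition abs_series_cvg (K : numFieldType) : Prop :=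
  forall (u : nat -> K) (M : K), (forall n : nat, \sum_(i < n) `|u i| <= M) ->
  exists l : K, (fun n : nat => \sum_(i < n) u i) @ \oo --> l.

Lemma cvg_numP (K : numFieldType) (u : nat -> K) (l : K) :
  u @ \oo --> l <-> forall e, 0 < e -> \forall n \near \oo, `|l - u n| < e.
Proof. exact: cvgrPdist_lt. Qed.

Lemma complex_abs_series_cvg (R : realType) : abs_series_cvg R[i].
Proof.
move=> u M uM.
(* [M] is a priori any element of [R[i]]; the empty partial sum gives [0 <= M], hence [M] is
   real. *)
have realM : M \is Num.real by apply: ger0_real; have := uM 0; rewrite big_ord0.
have part_cvg (f : R[i] -> R) :
    (forall z, `|f z|%:C%C <= `|z|) -> cvgn (series (f \o u)).
  move=> f_le; apply: normed_cvg; apply: nondecreasing_is_cvgn.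
    by apply: nondecreasing_series => n _ _ /=; exact: normr_ge0.
  exists (complex.Re M) => _ [n _ <-].
  rewrite -lecR RRe_real//; apply: le_trans (uM n).
  rewrite /normed_series_of seriesEord/= rmorph_sum/=.
  by apply: ler_sum => i _; exact: f_le.
have /cvg_ex[/= a cvg_a] := @part_cvg (@complex.Re R) (@normc_ge_Re R).
have Im_le (z : R[i]) : `|complex.Im z|%:C%C <= `|z|.
  by case: z => x y; rewrite normc_def lecR/= -sqrtr_sqr ler_wsqrtr// lerDr sqr_ge0.
have /cvg_ex[/= b cvg_b] := @part_cvg (@complex.Im R) Im_le.
exists (a +i* b)%C; apply/cvg_numP => e e0.
have eE : (complex.Re e)%:C%C = e by rewrite RRe_real// gtr0_real.
have e2 : 0 < complex.Re e / 2 by rewrite divr_gt0// -ltcR eE.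
move/cvgrPdist_lt/(_ _ e2) : cvg_a => cvg_a; move/cvgrPdist_lt/(_ _ e2) : cvg_b => cvg_b.
near=> n.
have -> : (a +i* b)%C - \sum_(i < n) u i
    = (a - series (@complex.Re R \o u) n)%:C%C + 'i%C * (b - series (@complex.Im R \o u) n)%:C%C.
  have -> : \sum_(i < n) u i
      = (series (@complex.Re R \o u) n)%:C%C + 'i%C * (series (@complex.Im R \o u) n)%:C%C.
    rewrite !seriesEord/= !rmorph_sum mulr_sumr -big_split/=.
    by apply: eq_bigr => i _; exact: complexE.
  rewrite [(a +i* b)%C]complexE/= !rmorphB/=; ring.
apply: le_lt_trans (ler_normD _ _) _; rewrite normrM.
have -> : `|'i%C : R[i]| = 1 by rewrite normc_def/= expr0n expr1n add0r sqrtr1.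
have normC (x : R) : `|x%:C%C| = `|x|%:C%C :> R[i].
  by rewrite normc_def/= expr0n addr0 sqrtr_sqr.
rewrite mul1r !normC -rmorphD/= -eE ltcR [ltRHS](splitr (complex.Re e)).
by apply: ltrD; near: n.
Unshelve. all: by end_near. Qed.

Definition expands1 (K : numFieldType) (f : K -> K) (c : nat -> K) : Prop :=
  exists r : K, [/\ 0 < r,
    exists M : K, forall n : nat, \sum_(i < n) `|c i| * r ^+ i <= M
    & forall y : K, `|y| < r ->
      (fun n : nat => \sum_(i < n) c i * y ^+ i) @ \oo --> f y].

Lemma cvg_horner (K : numFieldType) (T : Type) (F : set_system T) (FF : Filter F)
    (p : {poly K}) (u : T -> K) (l : K) :
  u @ F --> l -> (fun n => p.[u n]) @ F --> p.[l].
Proof.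
move=> ul; elim/poly_ind: p => [|p a IH].
  by rewrite horner0; under eq_fun do rewrite horner0; exact: cvg_cst.
rewrite hornerMXaddC; under eq_fun do rewrite hornerMXaddC.
by apply: cvgD; [exact: cvgM|exact: cvg_cst].
Qed.

Lemma sum_geometric_le (K : numFieldType) (z : K) (n : nat) :
  0 <= z < 1 -> \sum_(i < n) z ^+ i <= (1 - z)^-1.
Proof.
move=> /andP[z0 z1]; rewrite -[leRHS]mul1r ler_pdivlMr ?subr_gt0//.
rewrite mulrC -opprB mulNr -subrX1 opprB lerBlDr lerDl.
exact: exprn_ge0.
Qed.

Lemma abs_series_cvg_expr (K : numFieldType) (z : K) :
  abs_series_cvg K -> 0 <= z < 1 -> (fun n => z ^+ n) @ \oo --> 0.
Proof.
move=> cK z01; have [z0 _] := andP z01.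
have [|l sl] := cK (fun i => z ^+ i) (1 - z)^-1.
  move=> n; under eq_bigr do rewrite normrX ger0_norm//.
  exact: sum_geometric_le.
apply: (@cvg_series_cvg_0 K K^o (fun n => z ^+ n)).
by apply/cvg_ex; exists l; rewrite seriesEord.
Qed.

(** * Convergent fixed points of X-adic contractions *)

Section FixedPoint.
Variables (K : numFieldType) (Q : {poly {poly K}}).
Hypotheses (Q0 : 'X %| Q`_0) (Q1 : 'X %| Q`_1).

Let T n := iter n (horner Q) 0.

Let TS n : T n.+1 = Q.[T n]. Proof. by []. Qed.

Let X_dvd_T n : 'X %| T n.
Proof.
elim: n => [|n IH]; first exact: dvdp0.
rewrite TS -[Q.[_]](subrK Q.[0]) dvdp_add//; last by rewrite horner_coef0.
by apply: dvdp_trans (dvdp_horner_sub Q 0 (T n)); rewrite subr0.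
Qed.

(** X-adic contraction: the constant term cancels, the terms of degree at least 2 contribute a
    factor [S] or [S'], the linear term contributes its coefficient, and each of these is divisible
    by ['X]. *)
Let hornerQ_sub (S S' : {poly K}) : 'X %| S -> 'X %| S' ->
  'X * (S - S') %| Q.[S] - Q.[S'].
Proof.
move=> XS XS'; pose H := drop_poly 2 Q.
have QE U : Q.[U] = H.[U] * U ^+ 2 + Q`_1 * U + Q`_0.
  rewrite -{1}(poly_take_drop 2 Q) hornerD hornerM hornerXn addrC -addrA.
  congr (_ + _); rewrite (horner_coef_wide _ (size_take_poly 2 Q)).
  by rewrite big_ord_recl big_ord1 /= !coef_take_poly/= expr1 mulr1 addrC.
have -> : Q.[S] - Q.[S'] = S * S * (H.[S] - H.[S'])
    + (S + S') * H.[S'] * (S - S') + Q`_1 * (S - S').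
  by rewrite !QE; ring.
rewrite !dvdp_add//.
- by apply: dvdp_mul; [exact: dvdp_mulr|exact: dvdp_horner_sub].
- by apply: dvdp_mul => //; apply: dvdp_mulr; exact: dvdp_add.
- exact: dvdp_mul.
Qed.

Let T_stable n : 'X^(n.+1) %| T n.+1 - T n.
Proof.
elim: n => [|n IH]; first by rewrite subr0 expr1.
rewrite [T n.+2]TS [in X in _ - X]TS exprS.
apply: dvdp_trans (hornerQ_sub (X_dvd_T _) (X_dvd_T _)).
exact: dvdp_mul.
Qed.

Let c i := (T i.+1)`_i.

Let coefT m i : (i < m)%N -> (T m)`_i = c i.
Proof.
elim: m => // m IH; rewrite ltnS leq_eqVlt => /predU1P[->//|lt_im].
rewrite -(IH lt_im); apply/eqP; rewrite -subr_eq0 -coefB.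
have /dvdpP[q ->] := T_stable m.
by rewrite coefMXn ltnS ltnW.
Qed.

(** [M] and [r] are tuned so that [C * (r + M ^+ 2) = M]. Then [Q] preserves the ball of radius [M]
    for [weight r]: the coefficients of degree 0 and 1, being divisible by ['X], gain a factor [r],
    and the powers from the second on contribute at most [M ^+ 2]. *)
Let C : K := 1 + \sum_(i < size Q) weight 1 Q`_i.
Let M : K := (C *+ 2)^-1.
Let r : K := M / (C *+ 2).

Let C_ge1 : 1 <= C.
Proof. by rewrite lerDl sumr_ge0// => i _; rewrite weight_ge0. Qed.

Let C2_ge1 : 1 <= C *+ 2.
Proof. by rewrite mulr2n (le_trans C_ge1)// lerDl (le_trans ler01). Qed.

Let M_gt0 : 0 < M. Proof. by rewrite invr_gt0 (lt_le_trans ltr01). Qed.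
Let M_le1 : M <= 1. Proof. by rewrite invf_le1 ?(lt_le_trans ltr01). Qed.
Let r_gt0 : 0 < r. Proof. by rewrite divr_gt0// (lt_le_trans ltr01). Qed.
Let r_le1 : r <= 1.
Proof. by rewrite ler_pdivrMr ?mul1r ?(lt_le_trans ltr01)// (le_trans M_le1). Qed.

Let weight_small (p : {poly K}) : 'X %| p -> weight r p <= r * weight 1 p.
Proof.
move=> /dvdpP[q ->]; rewrite -['X]expr1 !weightMX expr1n mulr1 expr1 mulrC.
by apply: ler_wpM2l; [exact: ltW|apply: le_weight => //; exact: ltW].
Qed.

Let weight_T n : weight r (T n) <= M.
Proof.
have r0 := ltW r_gt0; have M0 := ltW M_gt0.
elim: n => [|n IH]; first by rewrite weight0 ltW.
rewrite TS horner_coef; apply: le_trans (weight_sum _ _ _ r0) _.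
apply: (@le_trans _ _ (\sum_(i < size Q) weight 1 Q`_i * (r + M ^+ 2))).
  apply: ler_sum => i _; apply: le_trans (weightM _ _ r0) _.
  have W0 := weight_ge0 Q`_i (@ler01 K).
  have leT : weight r (T n ^+ i) <= M ^+ i.
    by apply: le_trans (weightX _ _ r0) _; rewrite lerXn2r ?nnegrE ?weight_ge0.
  have lew : weight r Q`_i <= weight 1 Q`_i by exact: le_weight.
  have M2 : 0 <= M ^+ 2 by exact: exprn_ge0.
  have small (j : nat) : 'X %| Q`_j -> weight r Q`_j * weight r (T n ^+ i)
      <= weight 1 Q`_j * (r + M ^+ 2).
    move=> XQ; apply: (@le_trans _ _ (r * weight 1 Q`_j * 1)).
      apply: ler_pM; rewrite ?weight_ge0 ?weight_small//.
      by apply: le_trans leT _; rewrite exprn_ile1.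
    by rewrite mulr1 mulrC ler_wpM2l ?weight_ge0// lerDl.
  case: i leT small lew W0 => -[|[|i]] lti /= leT small lew W0; try exact: small.
  apply: ler_pM; rewrite ?weight_ge0//.
  apply: le_trans leT _; apply: (@le_trans _ _ (M ^+ 2)); last by rewrite lerDr.
  by rewrite -addn2 exprD ler_piMl// exprn_ile1.
rewrite -mulr_suml; apply: (@le_trans _ _ (C * (r + M ^+ 2))).
  by rewrite ler_wpM2r ?addr_ge0 ?exprn_ge0// lerDr.
have Cn0 : C != 0 by rewrite gt_eqF// (lt_le_trans ltr01).
by rewrite /r /M le_eqVlt; apply/orP; left; apply/eqP; field.
Qed.

(* The iterates of Q starting at 0 stabilise coefficient by coefficient and stay
   in a ball of a weighted l1 norm; this yields the convergence of the limit
   series without any majorant series. *)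
Lemma fixed_point_series : abs_series_cvg K ->
  exists g : K -> K, exists c : nat -> K, [/\ expands1 g c, c 0 = 0
    & exists2 r : K, 0 < r & forall y, `|y| < r -> Q.[(g y)%:P].[y] = g y].
Proof.
move=> cK; have r0 := ltW r_gt0.
have sumE n y : \sum_(i < n) c i * y ^+ i = (take_poly n (T n)).[y].
  rewrite (horner_coef_wide _ (size_take_poly _ _)).
  by apply: eq_bigr => i _; rewrite coef_take_poly ltn_ord coefT.
have bound n : \sum_(i < n) `|c i| * r ^+ i <= M.
  apply: le_trans (weight_T n); apply: le_trans (weight_take _ n r0).
  rewrite (weightE _ (size_take_poly _ _)).
  by apply: ler_sum => i _; rewrite coef_take_poly ltn_ord coefT.
have lim_ex : forall y : K, exists l : K, `|y| < r ->
    (fun n : nat => \sum_(i < n) c i * y ^+ i) @ \oo --> l.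
  move=> y.
  have [yr|] := boolP (`|y| < r); last by exists 0.
  have [|l] := cK (fun i => c i * y ^+ i) M; last by exists l.
  move=> n; apply: le_trans (bound n); apply: ler_sum => i _.
  by rewrite normrM normrX ler_wpM2l// lerXn2r ?nnegrE// ltW.
have [g gP] := choice lim_ex.
exists g, c; split; first by exists r; split=> //; exists M.
  have /dvdpP[q qE] := X_dvd_T 1.
  by rewrite /c qE coefMX eqxx.
exists r => // y yr.
have Tg : (fun n => (T n).[y]) @ \oo --> g y.
  rewrite -[g y]addr0.
  (* [T n] and the n-th partial sum differ by a multiple of ['X^n] of weight at most [M + M], whose
     value at [y] tends to 0. *)
  have -> : (fun n => (T n).[y]) = (fun n => \sum_(i < n) c i * y ^+ i
      + (T n - take_poly n (T n)).[y]).
    by apply/funext => n; rewrite sumE -hornerD addrC subrK.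
  apply: cvgD; first exact: gP.
  have z01 : 0 <= `|y| / r < 1 by rewrite divr_ge0//= ltr_pdivrMr// mul1r.
  have /cvg_numP zn := abs_series_cvg_expr cK z01.
  apply/cvg_numP => e e0.
  have eM : 0 < e / (M + M) by rewrite divr_gt0// addr_gt0.
  have := zn _ eM; apply: filterS => n.
  rewrite sub0r normrN ger0_norm ?exprn_ge0 ?(andP z01).1// => small.
  rewrite sub0r normrN; apply: (@le_lt_trans _ _ ((M + M) * (`|y| / r) ^+ n)).
    have XT : 'X^n %| T n - take_poly n (T n).
      by rewrite -{1}(poly_take_drop n (T n)) addrC addKr dvdp_mull.
    apply: le_trans (norm_horner_dvdXn r_gt0 (ltW yr) XT) _.
    rewrite ler_wpM2r ?exprn_ge0 ?(andP z01).1//.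
    apply: le_trans (weightD _ _ r0) _; rewrite weightN lerD//.
    exact: le_trans (weight_take _ _ r0) _.
  by rewrite mulrC -ltr_pdivlMr ?addr_gt0.
have hornerQ (U : {poly K}) : Q.[U].[y] = (map_poly (horner_eval y) Q).[U.[y]].
  by rewrite (horner_map (horner_eval y) Q U).
rewrite hornerQ hornerC.
have TSg : (fun n => (T n.+1).[y]) @ \oo --> g y.
  by have := Tg; rewrite -(cvg_shiftS (fun n => (T n).[y])).
have QTg : (fun n => (T n.+1).[y]) @ \oo --> (map_poly (horner_eval y) Q).[g y].
  have -> : (fun n => (T n.+1).[y])
      = (fun n => (map_poly (horner_eval y) Q).[(T n).[y]]).
    by apply/funext => n; rewrite -hornerQ.
  exact: cvg_horner.
exact: (@norm_cvg_unique K K^o _ _ _ _ QTg TSg).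
Qed.

End FixedPoint.

(** * Jets of analytic functions *)

Section Jets.
Variable K : numFieldType.
Implicit Types (f : K * K -> K) (s : K * K) (c : nat -> nat -> K).

Definition jet c (N : nat) : {poly {poly K}} :=
  \poly_(i < N) \poly_(j < N) c i j.

Lemma horner_jet c N x y :
  (jet c N).[x, y] = \sum_(i < N) \sum_(j < N) c i j * x ^+ i * y ^+ j.
Proof.
rewrite /jet horner_poly horner_sum; apply: eq_bigr => i _.
rewrite hornerM horner_poly -rmorphXn hornerC mulr_suml.
by apply: eq_bigr => j _; rewrite mulrAC.
Qed.

(* K is only partially ordered, so a common bound t replaces max(|x|, |y|). *)
Definition small_order (N : nat) (g : K -> K -> K) : Prop :=
  exists C r : K, 0 < r /\ forall t x y : K,
    t < r -> `|x| <= t -> `|y| <= t -> `|g x y| <= C * t ^+ N.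

Lemma le_norm_cvg (u : nat -> K) (l a B : K) (n0 : nat) : u @ \oo --> l ->
  (forall n, (n0 <= n)%N -> `|u n - a| <= B) -> `|l - a| <= B.
Proof.
move=> /cvg_numP ul uB.
have B0 : 0 <= B by exact: le_trans (uB n0 (leqnn _)).
have [//|/negP lt] := boolP (`|l - a| <= B); exfalso; apply: lt.
rewrite real_leNgt ?ger0_real//; apply/negP; rewrite -subr_gt0 => e0.
have [n1 _ un] := ul _ e0.
have := un (maxn n0 n1) (leq_maxr _ _); apply/negP.
rewrite -real_leNgt ?ger0_real//; last exact: ltW.
rewrite lerBlDr; apply: le_trans (ler_distD (u (maxn n0 n1)) _ _) _.
by rewrite lerD2l uB// leq_maxl.
Qed.

(** Every monomial outside the N by N square has total degree at least N, so the tail is at most (t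
    / r)^N times the absolute sum at radius r. *)
Lemma expands_jet f s c N : expands f s c ->
  small_order N (fun x y => f (s.1 + x, s.2 + y) - (jet c N).[x, y]).
Proof.
move=> [r [r0 [M cM] cvgf]]; exists (M / r ^+ N), r; split=> // t x y tr xt yt.
have t0 : 0 <= t by exact: le_trans (normr_ge0 x) xt.
apply: (le_norm_cvg (n0 := N)
  (cvgf x y (le_lt_trans xt tr) (le_lt_trans yt tr))) => n Nn.
rewrite horner_jet.
have -> : \sum_(i < N) \sum_(j < N) c i j * x ^+ i * y ^+ j
  = \sum_(i < n) \sum_(j < n)
      (if (i < N)%N && (j < N)%N then c i j * x ^+ i * y ^+ j else 0).
  rewrite (big_ord_widen n (fun i => \sum_(j < N) c i j * x ^+ i * y ^+ j) Nn).
  rewrite big_mkcond; apply: eq_bigr => i _; case: ifP => iN; last by rewrite big1.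
  by rewrite (big_ord_widen n (fun j => c i j * x ^+ i * y ^+ j) Nn) big_mkcond.
rewrite -sumrB; apply: le_trans (ler_norm_sum _ _ _) _.
have tr1 : t / r <= 1 by rewrite ler_pdivrMr// mul1r ltW.
have trN : 0 <= (t / r) ^+ N by rewrite exprn_ge0 ?divr_ge0// ltW.
rewrite -mulrA [_^-1 * _]mulrC -expr_div_n.
apply: (@le_trans _ _
    (\sum_(i < n) \sum_(j < n) `|c i j| * r ^+ (i + j) * (t / r) ^+ N)).
  apply: ler_sum => i _; rewrite -sumrB; apply: le_trans (ler_norm_sum _ _ _) _.
  apply: ler_sum => j _; case: ifP => ijN.
    rewrite subrr normr0 mulr_ge0// mulr_ge0// exprn_ge0//; exact: ltW.
  rewrite subr0 !normrM !normrX -!mulrA ler_wpM2l//.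
  apply: (@le_trans _ _ (r ^+ (i + j) * (t / r) ^+ (i + j))).
    rewrite expr_div_n mulrCA mulfV ?expf_neq0 ?gt_eqF// mulr1 exprD.
    by apply: ler_pM; rewrite ?exprn_ge0// lerXn2r// nnegrE.
  rewrite ler_wpM2l ?exprn_ge0//; first exact: ltW.
  rewrite ler_wiXn2l// ?divr_ge0//; first exact: ltW.
  by move/negbT: ijN; rewrite negb_and -!leqNgt; lia.
under eq_bigr do rewrite -mulr_suml.
by rewrite -mulr_suml ler_wpM2r.
Qed.

Lemma small_orderD N g h : small_order N g -> small_order N h ->
  small_order N (fun x y => g x y + h x y).
Proof.
move=> [C [r [r0 gC]]] [C' [r' [r'0 hC]]].
have [rr' | r'r] := real_leP (gtr0_real r0) (gtr0_real r'0).
- exists (C + C'), r; split=> // t x y tr xt yt; rewrite mulrDl.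
  by apply: le_trans (ler_normD _ _) _; rewrite lerD ?gC ?hC// (lt_le_trans tr).
- exists (C + C'), r'; split=> // t x y tr xt yt; rewrite mulrDl.
  apply: le_trans (ler_normD _ _) _; rewrite lerD ?gC ?hC//.
  exact: lt_trans r'r.
Qed.

Lemma small_orderM N g h : small_order 0 g -> small_order N h ->
  small_order N (fun x y => g x y * h x y).
Proof.
move=> [C [r [r0 gC]]] [C' [r' [r'0 hC]]].
have [rr' | r'r] := real_leP (gtr0_real r0) (gtr0_real r'0).
- exists (C * C'), r; split=> // t x y tr xt yt; rewrite normrM -mulrA.
  have := gC _ _ _ tr xt yt; rewrite mulr1 => gb.
  by apply: ler_pM; rewrite // hC// (lt_le_trans tr).
- exists (C * C'), r'; split=> // t x y tr xt yt; rewrite normrM -mulrA.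
  have := gC _ _ _ (lt_trans tr r'r) xt yt; rewrite mulr1 => gb.
  by apply: ler_pM; rewrite // hC.
Qed.

Lemma small_orderW N g : small_order N g -> small_order 0 g.
Proof.
move=> [C [r [r0 gC]]]; exists (`|C| * r ^+ N), r; split=> // t x y tr xt yt.
have t0 : 0 <= t by exact: le_trans (normr_ge0 x) xt.
have g_le := gC _ _ _ tr xt yt.
rewrite mulr1; apply: (le_trans g_le).
have [->|C0] := eqVneq C 0; first by rewrite normr0 !mul0r.
apply: (@le_trans _ _ (`|C| * t ^+ N)); last first.
  by rewrite ler_wpM2l// lerXn2r ?nnegrE// ltW// (le_lt_trans t0).
(* [C] is not assumed real; where [t ^+ N] is nonzero, the bound itself forces [0 <= C]. *)
have := le_trans (normr_ge0 _) g_le; have [->|tn0] := eqVneq (t ^+ N) 0.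
  by rewrite !mulr0.
have tN : 0 < t ^+ N by rewrite lt_def tn0 exprn_ge0.
by rewrite pmulr_lge0// => C_ge0; rewrite ger0_norm.
Qed.

Lemma small_order_near N g h (d : K) : 0 < d ->
  (forall x y, `|x| < d -> `|y| < d -> g x y = h x y) ->
  small_order N h -> small_order N g.
Proof.
move=> d0 gh [C [r [r0 hC]]].
have [rd | dr] := real_leP (gtr0_real r0) (gtr0_real d0).
- exists C, r; split=> // t x y tr xt yt.
  by rewrite gh ?hC// (le_lt_trans _ (lt_le_trans tr rd)).
- exists C, d; split=> // t x y td xt yt.
  by rewrite gh ?hC// ?(lt_trans td dr)// (le_lt_trans _ td).
Qed.

Lemma small_order_cst a : small_order 0 (fun _ _ => a).
Proof. by exists `|a|, 1; split=> // t x y _ _ _; rewrite mulr1. Qed.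

Lemma small_order0 N : small_order N (fun _ _ => 0).
Proof. by exists 0, 1; split=> // t x y _ _ _; rewrite normr0 mul0r. Qed.

Lemma small_order_horner (A : {poly {poly K}}) :
  small_order 0 (fun x y => A.[x, y]).
Proof.
have ext g h : g =2 h -> small_order 0 h -> small_order 0 g.
  by move=> gh; apply: (@small_order_near _ _ _ 1).
have id0 : small_order 0 (fun x _ => x) /\ small_order 0 (fun _ y => y).
  by split; exists 1, 1; split=> // t x y t1 xt yt; rewrite mulr1;
     [apply: le_trans xt _|apply: le_trans yt _]; exact: ltW.
have inner (p : {poly K}) : small_order 0 (fun _ y => p.[y]).
  elim/poly_ind: p => [|p a IH].
    by apply: (@ext _ (fun _ _ => 0)) (small_order0 0) => x y; rewrite horner0.
  apply: (@ext _ (fun x y => p.[y] * y + a)).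
    by move=> x y; rewrite hornerMXaddC.
  by apply: small_orderD (small_order_cst a); apply: small_orderM => //; exact: id0.2.
elim/poly_ind: A => [|A p IH].
  by apply: (@ext _ (fun _ _ => 0)) (small_order0 0) => x y; rewrite !horner0.
apply: (@ext _ (fun x y => A.[x, y] * x + p.[y])).
  by move=> x y; rewrite hornerMXaddC hornerD hornerM hornerC.
by apply: small_orderD (inner p); apply: small_orderM => //; exact: id0.1.
Qed.

Definition approx N (g : K -> K -> K) (A : {poly {poly K}}) : Prop :=
  small_order N (fun x y => g x y - A.[x, y]).

Lemma approxM N g h A B : approx N g A -> approx N h B ->
  approx N (fun x y => g x y * h x y) (A * B).
Proof.
move=> gA hB; apply: (@small_order_near _ _ (fun x y =>
    (g x y - A.[x, y]) * (h x y - B.[x, y])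
    + (A.[x, y] * (h x y - B.[x, y]) + B.[x, y] * (g x y - A.[x, y]))) 1) => //.
  by move=> x y _ _; rewrite !hornerM; ring.
apply: small_orderD; first by apply: small_orderM => //; exact: small_orderW gA.
by apply: small_orderD; apply: small_orderM => //; exact: small_order_horner.
Qed.

Lemma approxX N g A k : approx N g A -> approx N (fun x y => g x y ^+ k) (A ^+ k).
Proof.
move=> gA; elim: k => [|k IH].
  apply: (@small_order_near _ _ (fun _ _ => 0) 1) (small_order0 _) => // x y _ _.
  by rewrite !expr0 !hornerC subrr.
apply: (@small_order_near _ _ (fun x y => g x y * g x y ^+ k - (A * A ^+ k).[x, y]) 1) => //.
  by move=> x y _ _; rewrite -!exprS.
exact: approxM.
Qed.

Lemma approxB N g h A B : approx N g A -> approx N h B ->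
  approx N (fun x y => g x y - h x y) (A - B).
Proof.
move=> gA hB; apply: (@small_order_near _ _ (fun x y =>
    (g x y - A.[x, y]) + (- 1) * (h x y - B.[x, y])) 1) => //.
  by move=> x y _ _; rewrite !hornerD !hornerN; ring.
by apply: small_orderD => //; apply: small_orderM => //; exact: small_order_cst.
Qed.

Definition ord_ge N (A : {poly {poly K}}) : Prop :=
  forall i j : nat, (i + j < N)%N -> A`_i`_j = 0.

Lemma poly_vanish_nat (p : {poly K}) : (forall n : nat, p.[n%:R] = 0) -> p = 0.
Proof.
move=> p0; apply/eqP; apply: contraT => pn0.
have := @max_poly_roots _ p [seq n%:R | n <- iota 0 (size p)] pn0.
rewrite size_map size_iota ltnn; apply.
  by apply/allP => _ /mapP[n _ ->]; rewrite /root p0.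
by rewrite map_inj_uniq ?iota_uniq//; exact: mulrIn (oner_neq0 K).
Qed.

Lemma small_horner_dvdXn (p : {poly K}) N (C r : K) : 0 < r ->
  (forall t, 0 < t -> t < r -> `|p.[t]| <= C * t ^+ N) -> 'X^N %| p.
Proof.
move=> r0; elim: N p => [|N IH] p pC; first by rewrite expr0 dvd1p.
suff /factor_theorem[q pE] : root p 0.
  rewrite subr0 in pE; rewrite pE exprSr dvdp_mul2r ?polyX_eq0//.
  apply: IH => t t0 tr; have := pC _ t0 tr.
  rewrite pE hornerM hornerX normrM (gtr0_norm t0) exprSr mulrA.
  by rewrite ler_pM2r.
have [q pE] : exists q, p = q * 'X + (p.[0])%:P.
  have /factor_theorem[q qE] : root (p - (p.[0])%:P) 0.
    by rewrite /root !hornerE subrr.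
  by exists q; apply/eqP; rewrite -subr_eq qE subr0.
set a := p.[0] in pE *.
pose W := weight r q; have W0 : 0 <= W by apply: weight_ge0; exact: ltW.
pose B := `|C| * r ^+ N + W.
have rN : 0 <= r ^+ N by rewrite exprn_ge0// ltW.
have B0 : 0 <= B by rewrite addr_ge0// mulr_ge0.
have aB t : 0 < t -> t < r -> `|a| <= B * t.
  move=> t0 tr; have -> : a = p.[t] - q.[t] * t by rewrite pE !hornerE addrC addKr.
  apply: le_trans (ler_normB _ _) _; rewrite mulrDl lerD//.
    apply: le_trans (pC _ t0 tr) _; rewrite exprSr mulrA ler_wpM2r ?(ltW t0)//.
    have := le_trans (normr_ge0 _) (pC _ t0 tr).
    rewrite pmulr_lge0 ?exprn_gt0// => C0; rewrite (ger0_norm C0) ler_wpM2l//.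
    by rewrite lerXn2r ?nnegrE ?ltW.
  rewrite normrM (gtr0_norm t0) ler_wpM2r ?(ltW t0)//.
  by apply: norm_horner_le; rewrite gtr0_norm// ltW.
rewrite /root -/a -normr_eq0; apply: contraT => an0.
have a0 : 0 < `|a| by rewrite lt_def an0 normr_ge0.
have BD : 0 < B + B + `|a| / r *+ 2.
  by apply: ltr_wpDl; [exact: addr_ge0|rewrite pmulrn_lgt0// divr_gt0].
(* This value of t satisfies both t < r and B t < |a|, which contradicts [aB]; the summand |a| / r
   keeps the denominator positive even if [B] is 0. *)
have t0 : 0 < `|a| / (B + B + `|a| / r *+ 2) by rewrite divr_gt0.
have tr : `|a| / (B + B + `|a| / r *+ 2) < r.
  have rn0 : r != 0 by rewrite gt_eqF.
  have rE : r * (B + B + `|a| / r *+ 2) = r * (B + B) + (`|a| + `|a|) by field.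
  rewrite ltr_pdivrMr// rE; apply: ltr_wpDl; last by rewrite ltrDl.
  by apply: mulr_ge0; [exact: ltW|exact: addr_ge0].
have := aB _ t0 tr; rewrite mulrCA ler_pMr// ler_pdivlMr// mul1r => BB.
suff lt : B < B + B + `|a| / r *+ 2 by have := lt_le_trans lt BB; rewrite ltxx.
rewrite -addrA ltrDl.
by apply: ltr_wpDl => //; rewrite pmulrn_lgt0// divr_gt0.
Qed.

(** On the line x = n y the coefficient of y^d is B(n), where B collects the coefficients of total
    degree d. It vanishes for every natural number n, hence B = 0. *)
Lemma small_order_ord (A : {poly {poly K}}) N :
  small_order N (fun x y => A.[x, y]) -> ord_ge N A.
Proof.
move=> [C [r [r0 AC]]] i j ijN; set d := (i + j)%N in ijN.
pose B := \poly_(i < d.+1) A`_i`_(d - i).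
suff B0 : B = 0.
  by have := congr1 (fun p : {poly K} => p`_i) B0;
     rewrite coef_poly ltnS leq_addr addKn coef0.
apply: poly_vanish_nat => n.
have coefE : B.[n%:R] = (A.[n%:R *: 'X])`_d.
  rewrite (@horner_coef_wide _ (d.+1 + size A) B); last first.
    by rewrite (leq_trans (size_poly _ _))// leq_addr.
  rewrite (@horner_coef_wide _ (d.+1 + size A) A) ?leq_addl// coef_sum.
  apply: eq_bigr => m _; rewrite exprZn -scalerAr coefZ coefMXn coef_poly ltnS.
  by rewrite leqNgt; case: ltnP => _; rewrite ?mul0r ?mulr0// mulrC.
rewrite coefE; have /dvdpP[q ->] : 'X^N %| A.[n%:R *: 'X].
  have n1 : 0 < n.+1%:R :> K by rewrite ltr0n.
  apply: (@small_horner_dvdXn _ _ (C * n.+1%:R ^+ N) (r / n.+1%:R)).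
    by rewrite divr_gt0.
  move=> t t0; rewrite ltr_pdivlMr// => tr.
  rewrite -mulrA -exprMn mulrC [_ * t]mulrC.
  have -> : (A.[n%:R *: 'X]).[t] = A.[n%:R * t, t].
    rewrite -[LHS]/(horner_eval t A.[n%:R *: 'X]) -horner_map/=.
    rewrite -[RHS]/(horner_eval t A.[(n%:R * t)%:P]) -horner_map/=.
    by rewrite /horner_eval !hornerE.
  rewrite mulrC; apply: AC => //.
    by rewrite normrM normr_nat (gtr0_norm t0) [leRHS]mulrC ler_pM2r// ler_nat.
  by rewrite gtr0_norm// ler_peMr ?(ltW t0)// ler1n.
by rewrite coefMXn ijN.
Qed.

End Jets.

(** * Convergent power series in one variable *)

Section OneVariableGerms.
Variable K : numFieldType.
Implicit Types (f g : K -> K) (a c : nat -> K).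

(** Coefficients of f(y) + b (x - x0) at (x0, 0), the shape of all three functions in the normal
    form of the cubic. *)
Definition affine_coef c (b : K) (i j : nat) : K :=
  if i is i'.+1 then if (i' == 0)%N && (j == 0)%N then b else 0 else c j.

Lemma sum_affine_coef (T : zmodType) (w : K -> nat -> nat -> T) c b n :
  (forall i j, w 0 i j = 0) ->
  \sum_(i < n.+2) \sum_(j < n.+2) w (affine_coef c b i j) i j
  = \sum_(j < n.+2) w (c j) 0 j + w b 1 0.
Proof.
move=> w0; rewrite big_ord_recl/=; congr (_ + _).
rewrite big_ord_recl [X in _ + X]big1 => [|i _].
  by rewrite addr0 big_ord_recl big1 ?addr0 => [|j _]; rewrite /= ?w0.
by rewrite big1 => [|j _]; rewrite /= ?w0.
Qed.

Lemma expands_affine f c (b x0 : K) : expands1 f c ->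
  expands (fun z => f z.2 + b * (z.1 - x0)) (x0, 0) (affine_coef c b).
Proof.
move=> [r [r0 [M cM] cvgf]]; have r_ge0 := ltW r0.
have M0 : 0 <= M by have := cM 0; rewrite big_ord0.
exists r; split=> //.
  exists (M + `|b| * r) => n.
  pose W (z : K) (i j : nat) := `|z| * r ^+ (i + j).
  have W0 i j : W 0 i j = 0 by rewrite /W normr0 mul0r.
  have sumE := sum_affine_coef c b n W0.
  apply: (@le_trans _ _ (\sum_(i < n.+2) \sum_(j < n.+2) W (affine_coef c b i j) i j)).
    have Wge0 z i j : 0 <= W z i j by rewrite mulr_ge0 ?exprn_ge0.
    rewrite [leRHS]big_ord_recr big_ord_recr/= -addrA ler_wpDr//.
      by rewrite addr_ge0// sumr_ge0.
    apply: ler_sum => i _; rewrite [leRHS]big_ord_recr big_ord_recr/= -addrA.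
    by rewrite ler_wpDr// addr_ge0.
  by rewrite sumE /W addn0 expr1 lerD2r; exact: cM.
move=> x y xr yr; apply/cvg_numP => e e0 /=.
have /cvg_numP/(_ _ e0)[n0 _ n0P] := cvgf y yr.
exists n0.+2 => // -[//|[//|n]]; rewrite /= !ltnS => n0n.
pose W (z : K) (i j : nat) := z * x ^+ i * y ^+ j.
have W0 i j : W 0 i j = 0 by rewrite /W !mul0r.
rewrite (sum_affine_coef c b n W0) /W add0r.
have -> : x0 + x - x0 = x by rewrite addrC addKr.
rewrite expr1 [y ^+ 0]expr0 mulr1 opprD addrACA subrr addr0.
under eq_bigr do rewrite expr0 mulr1.
by apply: n0P => /=; rewrite (leq_trans n0n)// -addn2 leq_addr.
Qed.

Lemma expands1_affine f c (u v : K) : expands1 f c ->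
  expands1 (fun y => u + v * f y) (fun j => if j is 0%N then u + v * c 0%N else v * c j).
Proof.
move=> [r [r0 [M cM] cvgf]].
exists r; split=> //.
  exists (`|u| + `|v| * M) => -[|n].
    rewrite big_ord0 addr_ge0// mulr_ge0//.
    by have := cM 0; rewrite big_ord0.
  rewrite big_ord_recl expr0 mulr1.
  apply: (@le_trans _ _ (`|u| + `|v| * (\sum_(i < n.+1) `|c i| * r ^+ i))).
    rewrite [X in _ <= _ + _ * X]big_ord_recl expr0 mulr1 mulrDr addrA.
    rewrite -normrM; apply: lerD; first exact: ler_normD.
    rewrite mulr_sumr; apply: ler_sum => i _.
    by rewrite normrM mulrA.
  by rewrite lerD2l ler_wpM2l.
move=> y yr; apply: cvg_trans (cvgD (cvg_cst u) (cvgM (cvg_cst v) (cvgf y yr))).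
apply: near_eq_cvg; exists 1%N => // -[//|n] _ /=.
rewrite -[LHS]/(u + v * \sum_(i < n.+1) c i * y ^+ i).
rewrite [in RHS]big_ord_recl [in LHS]big_ord_recl/= !expr0 !mulr1 mulrDr addrA.
by congr (_ + _); rewrite mulr_sumr; apply: eq_bigr => i _; rewrite mulrA.
Qed.

Lemma expands1_mulX f c : expands1 f c ->
  expands1 (fun y => y * f y) (fun j => if j is j'.+1 then c j' else 0).
Proof.
move=> [r [r0 [M cM] cvgf]].
exists r; split=> //.
  exists (r * M) => -[|n].
    by rewrite big_ord0 mulr_ge0 ?(ltW r0)//; have := cM 0; rewrite big_ord0.
  rewrite big_ord_recl normr0 mul0r add0r.
  apply: (@le_trans _ _ (r * (\sum_(i < n) `|c i| * r ^+ i))).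
    by rewrite mulr_sumr; apply: ler_sum => i _; rewrite exprS mulrCA.
  by rewrite ler_wpM2l// ltW.
move=> y yr; rewrite -cvg_shiftS/=.
apply: cvg_trans (cvgM (cvg_cst y) (cvgf y yr)).
apply: near_eq_cvg; near=> n.
rewrite -[LHS]/(y * \sum_(i < n) c i * y ^+ i).
rewrite big_ord_recl mul0r add0r mulr_sumr.
by apply: eq_bigr => i _; rewrite exprS mulrCA.
Unshelve. all: by end_near. Qed.

Lemma expands1_cvg0 f c : expands1 f c -> f @ (0 : K) --> c 0%N.
Proof.
move=> /(expands_affine 0 0)/(expands_jet 1)[C [r [r0 fC]]].
have bound y : `|y| < r -> `|f y - c 0%N| <= (`|C| + 1) * `|y|.
  move=> yr; have := fC _ 0 y yr; rewrite normr0 => /(_ (normr_ge0 _) (lexx _)).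
  rewrite /= mul0r addr0 add0r horner_jet !big_ord1/= !expr0 !mulr1 => le.
  apply: le_trans le _; rewrite expr1 mulrDl mul1r.
  apply: ler_wpDr => //; have [->|y0] := eqVneq y 0; first by rewrite normr0 !mulr0.
  have := le_trans (normr_ge0 _) (fC _ 0 y yr _ (lexx _)).
  rewrite normr0 expr1 => /(_ (normr_ge0 _)).
  by rewrite pmulr_lge0 ?normr_gt0// => /ger0_norm->.
apply/(@cvgrPdist_lt K K^o _ (nbhs (0 : K)) _ f (c 0%N)) => e e0.
have C0 : 0 < `|C| + 1 by rewrite ltr_wpDl.
near=> y; rewrite distrC; apply: (@le_lt_trans _ _ ((`|C| + 1) * `|y|)).
  apply: bound; near: y; exact: (@nbhs0_lt K K^o).
rewrite mulrC -ltr_pdivlMr//; near: y; apply: (@nbhs0_lt K K^o); exact: divr_gt0.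
Unshelve. all: by end_near. Qed.

End OneVariableGerms.

Lemma implicit_root (K : numFieldType) (P : {poly {poly K}}) (h0 : K) :
  abs_series_cvg K -> P.[h0, 0] = 0 -> P^`().[h0, 0] != 0 ->
  exists h : K -> K, exists c : nat -> K, [/\ expands1 h c, c 0%N = h0
    & exists2 r : K, 0 < r & forall y, `|y| < r -> P.[h y, y] = 0].
Proof.
move=> cK P0 P'0; set a := P^`().[h0, 0] in P'0.
pose S := 'X + (h0%:P)%:P : {poly {poly K}}.
(* Newton map with the derivative frozen at the base point, centred at [h0]: its fixed points give
   the zeros of [P], and its coefficients of degree 0 and 1 vanish at y = 0. *)
pose Q := 'X - (a^-1)%:P%:P * (P \Po S).
have X_dvd (p : {poly K}) : p.[0] = 0 -> 'X %| p.
  by move=> p0; rewrite -['X]subr0 dvdp_XsubCl /root p0.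
have Q0 : 'X %| Q`_0.
  apply: X_dvd; rewrite -horner_coef0 /Q !hornerE horner_comp/= !hornerE.
  by rewrite P0 mulr0 oppr0.
have Q1 : 'X %| Q`_1.
  apply: X_dvd; have -> : Q`_1 = Q^`().[0] by rewrite horner_coef0 coef_deriv mulr1n.
  rewrite /Q derivB derivX derivM derivC mul0r add0r deriv_comp derivD derivX derivC.
  rewrite addr0 mulr1 !hornerE horner_comp !hornerE -/a mulVf// subrr//.
have [g [c [gc c0 [r r0 gr]]]] := fixed_point_series Q0 Q1 cK.
exists (fun y => h0 + 1 * g y); eexists; split; first exact: expands1_affine gc.
  by rewrite /= c0 mulr0 addr0.
exists r => // y yr; have := gr _ yr.
rewrite /Q !hornerE horner_comp !hornerE => /eqP.
rewrite -subr_eq0 addrAC subrr add0r oppr_eq0 mulf_eq0 invr_eq0 (negPf P'0)/=.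
by move/eqP; rewrite -polyCD addrC.
Qed.

(** * An A_k point from the discriminant of a cubic *)

Lemma expands1_at0 (K : numFieldType) (f : K -> K) (c : nat -> K) :
  expands1 f c -> f 0 = c 0%N.
Proof.
move=> [r [r0 _ cvgf]]; have := cvgf 0; rewrite normr0 => /(_ r0) cvg0.
have cst0 : (fun _ : nat => c 0%N) @ \oo --> c 0%N by exact: cvg_cst.
apply: (@norm_cvg_unique K K^o _ _ _ _ cvg0).
apply: cvg_trans cst0; apply: near_eq_cvg.
exists 1%N => // -[//|n] _; rewrite big_ord_recl expr0 mulr1 big1 ?addr0// => i _.
by rewrite expr0n/= mulr0.
Qed.

Definition cubic (K : numFieldType) (P Q : {poly K}) : {poly {poly K}} :=
  'X^3 - (3 *: P)%:P * 'X + (2 *: Q)%:P.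

Lemma horner_cubic (K : numFieldType) (P Q T : {poly K}) :
  (cubic P Q).[T] = T ^+ 3 - 3 *: P * T + 2 *: Q.
Proof. by rewrite /cubic !hornerE. Qed.

(* With rho the root of the cubic that is simple at 0, the other two roots are
   those of (x + rho / 2) ^ 2 - 3 / 4 * (4 P - rho ^ 2), and the last term v
   satisfies v (v - 3 P) ^ 2 = - 4 (Q ^ 2 - P ^ 3); hence U = y h with
   4 (y h) ^ (k + 1) = 3 v. *)
Lemma type_A_cubic (K : numClosedFieldType) (P Q D : {poly K}) (k : nat) :
  abs_series_cvg K -> (0 < k)%N -> Q ^+ 2 - P ^+ 3 = 'X^(k.+1) * D ->
  P.[0] != 0 -> D.[0] != 0 -> type_A (cubic P Q) (Q.[0] / P.[0], 0) k.
Proof.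
move=> cK k0 QPD P0 D0.
suff normal_form : exists U V E : K * K -> K,
    [/\ analytic_coordinates U V (Q.[0] / P.[0], 0),
      analytic_at E (Q.[0] / P.[0], 0), E (Q.[0] / P.[0], 0) != 0
    & \forall z \near ((Q.[0] / P.[0], 0) : K * K),
        (cubic P Q).[z.1, z.2] = E z * (V z ^+ 2 - U z ^+ k.+1)].
  by case: k k0 {QPD} normal_form.
set c := Q.[0] / P.[0].
have cE : c = Q.[0] / P.[0] by []; clearbody c.
have disc y : Q.[y] ^+ 2 - P.[y] ^+ 3 = y ^+ k.+1 * D.[y].
  by have := congr1 (fun p : {poly K} => p.[y]) QPD; rewrite !hornerE.
have Q0P0 : Q.[0] ^+ 2 = P.[0] ^+ 3.
  by apply/eqP; rewrite -subr_eq0 disc expr0n mul0r.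
have cP : P.[0] = c ^+ 2 by rewrite cE expr_div_n Q0P0; field.
have cQ : Q.[0] = c ^+ 3 by rewrite exprS -cP cE; field.
have c0 : c != 0 by apply: contraNneq P0; rewrite cP => ->; rewrite expr0n.
(* At y = 0 the cubic is (x - c)^2 (x + 2 c), so its simple root there is - 2 c. *)
have [] := @implicit_root K (cubic P Q) (- (2 * c)) cK.
- by rewrite horner_cubic !hornerE cP cQ; ring.
- rewrite /cubic !derivE !hornerE cP; set t := (X in X != 0).
  have -> : t = 9 * c ^+ 2 by rewrite /t; ring.
  by rewrite mulf_neq0 ?pnatr_eq0// expf_neq0.
move=> rho [rc [rho_exp rc0 [r1 r1_gt0 rhoP]]].
(* The equation v (v - 3 P)^2 = - 4 y^(k+1) D with v = 4/3 (y h)^(k+1), divided by y^(k+1) and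
   cleared of denominators. After this division h has a simple root at y = 0. *)
pose G : {poly {poly K}} :=
  'X^(k.+1) * ((4 *: 'X^(k.+1))%:P * 'X^(k.+1) - (9 *: P)%:P) ^+ 2 + (27 *: D)%:P.
pose h0 := (k.+1).-root (- (D.[0] / (3 * P.[0] ^+ 2))).
have h0E : h0 ^+ k.+1 = - (D.[0] / (3 * P.[0] ^+ 2)) by rewrite rootCK.
have h0n : h0 != 0.
  have : h0 ^+ k.+1 != 0; last by rewrite expf_eq0.
  rewrite h0E oppr_eq0 mulf_neq0// invr_neq0//.
  by rewrite mulf_neq0 ?pnatr_eq0// expf_neq0.
have [] := @implicit_root K G h0 cK.
- by rewrite /G !hornerE h0E expr0n/=; field.
- rewrite /G !derivE !hornerE expr0n/=; set w := ('X^k *+ k.+1).[_, _].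
  have w0 : w != 0.
    by rewrite /w !hornerMn !hornerE -mulr_natr mulf_neq0 ?expf_neq0 ?pnatr_eq0.
  set t := (X in X != 0); have -> : t = 81 * P.[0] ^+ 2 * w by rewrite /t; ring.
  by rewrite !mulf_neq0 ?pnatr_eq0// expf_neq0.
move=> h [hc [h_exp hc0 [r2 r2_gt0 hP]]].
pose v1 y := 4 * P.[y] - rho y ^+ 2.
pose v2 y := (4 / 3) * (y * h y) ^+ k.+1.
(* [B] is the cofactor of v1 - v2 in the difference of the values of v (v - 3 P)^2 at v1 and v2. Its
   limit 9 P(0)^2 is nonzero, so v1 = v2 near 0: both are the small root of the same equation. *)
pose B y := v1 y ^+ 2 + v1 y * v2 y + v2 y ^+ 2 - 6 * P.[y] * (v1 y + v2 y)
  + 9 * P.[y] ^+ 2.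
have P_cvg : (fun y : K => P.[y]) @ (0 : K) --> P.[0].
  by apply: (@cvg_horner K K (nbhs (0 : K)) _ P id 0); exact: cvg_id.
have rho_cvg : rho @ (0 : K) --> - (2 * c).
  by rewrite -rc0; exact: expands1_cvg0 rho_exp.
have h_cvg : h @ (0 : K) --> h0 by rewrite -hc0; exact: expands1_cvg0 h_exp.
have v1_cvg : v1 @ (0 : K) --> 4 * P.[0] - (- (2 * c)) ^+ 2.
  exact: cvgB (cvgM (cvg_cst _) P_cvg) (cvgM rho_cvg rho_cvg).
have v1_0 : 4 * P.[0] - (- (2 * c)) ^+ 2 = 0 by rewrite cP; ring.
rewrite v1_0 in v1_cvg.
have v2_cvg : v2 @ (0 : K) --> 4 / 3 * ('X^(k.+1)).[0 * h0].
  have -> : v2 = (fun y => 4 / 3 * ('X^(k.+1)).[y * h y]).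
    by apply/funext => y; rewrite hornerXn.
  have id_cvg : (fun y : K => y) @ (0 : K) --> (0 : K) by exact: cvg_id.
  have yh_cvg : (fun y => y * h y) @ (0 : K) --> 0 * h0 by exact: cvgM id_cvg h_cvg.
  have w_cvg : (fun y => ('X^(k.+1)).[y * h y]) @ (0 : K) --> ('X^(k.+1)).[0 * h0].
    exact: cvg_horner yh_cvg.
  exact: cvgM (cvg_cst _) w_cvg.
rewrite mul0r hornerXn expr0n mulr0 in v2_cvg.
have B_cvg : B @ (0 : K) -->
    0 ^+ 2 + 0 * 0 + 0 ^+ 2 - 6 * P.[0] * (0 + 0) + 9 * P.[0] ^+ 2.
  exact: cvgD (cvgB (cvgD (cvgD (cvgM v1_cvg v1_cvg) (cvgM v1_cvg v2_cvg))
    (cvgM v2_cvg v2_cvg)) (cvgM (cvgM (cvg_cst _) P_cvg) (cvgD v1_cvg v2_cvg)))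
    (cvgM (cvg_cst _) (cvgM P_cvg P_cvg)).
have B0 : \forall y \near (0 : K), B y != 0.
  apply: (@cvgr_neq0 K K^o _ _ _ B _ B_cvg).
  rewrite expr0n mulr0 !addr0 mulr0 subr0 add0r.
  by rewrite mulf_neq0 ?pnatr_eq0// expf_neq0.
(* U = y h(y), V = x + rho / 2 and E = x - rho, written in the form that [expands_affine]
   accepts. *)
exists (fun z => z.2 * h z.2 + 0 * (z.1 - c)),
  (fun z => c + 2^-1 * rho z.2 + 1 * (z.1 - c)),
  (fun z => c + (- 1) * rho z.2 + 1 * (z.1 - c)).
split.
- exists (affine_coef (fun j => if j is j'.+1 then hc j' else 0) 0).
  eexists; split => /=.
  + exact: (expands_affine _ _ (expands1_mulX h_exp)).
  + exact: (expands_affine _ _ (expands1_affine _ _ rho_exp)).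
  + by rewrite !mul0r addr0.
  + by rewrite (expands1_at0 rho_exp) rc0; field.
  + by rewrite /= mul0r sub0r mulr1 hc0 oppr_eq0.
- eexists; exact: (expands_affine _ _ (expands1_affine _ _ rho_exp)).
- rewrite /= (expands1_at0 rho_exp) rc0.
  have -> : c + -1 * - (2 * c) + 1 * (c - c) = 3 * c by ring.
  by rewrite mulf_neq0 ?pnatr_eq0.
- have near_good : \forall y \near (0 : K), (cubic P Q).[rho y, y] = 0 /\
      (G.[h y, y] = 0 /\ B y != 0).
    near=> y; split; first by apply: rhoP; near: y; exact: (@nbhs0_lt K K^o).
    split; first by apply: hP; near: y; exact: (@nbhs0_lt K K^o).
    by near: y.
  have : \forall z \near ((c, 0) : K * K), (cubic P Q).[rho z.2, z.2] = 0 /\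
      (G.[h z.2, z.2] = 0 /\ B z.2 != 0).
    exact: (cvg_snd near_good).
  apply: filterS => -[x y] [rhoE0 [hE0 By0]].
  have By : B y != 0 by exact: By0.
  rewrite -[LHS]/((cubic P Q).[x, y]).
  rewrite -[RHS]/((c + (- 1) * rho y + 1 * (x - c)) *
    ((c + 2^-1 * rho y + 1 * (x - c)) ^+ 2 - (y * h y + 0 * (x - c)) ^+ k.+1)).
  have rhoE : rho y ^+ 3 - 3 * P.[y] * rho y + 2 * Q.[y] = 0.
    by rewrite -[RHS]rhoE0 horner_cubic !hornerE.
  have hE : h y ^+ k.+1 * (4 * y ^+ k.+1 * h y ^+ k.+1 - 9 * P.[y]) ^+ 2
      + 27 * D.[y] = 0 by rewrite -[RHS]hE0 /G !hornerE; ring.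
  have -> : (cubic P Q).[x, y] = x ^+ 3 - 3 * P.[y] * x + 2 * Q.[y].
    by rewrite horner_cubic !hornerE.
  have v12 : v1 y = v2 y.
    apply/eqP; rewrite -subr_eq0 -(mulIr_eq0 _ (mulIf By)).
    have v1E : v1 y * (v1 y - 3 * P.[y]) ^+ 2 = - 4 * (y ^+ k.+1 * D.[y]).
      have QE : Q.[y] = (3 * P.[y] * rho y - rho y ^+ 3) / 2.
        apply: (mulIf (_ : 2 != 0 :> K)); first by rewrite pnatr_eq0.
        by rewrite divfK ?pnatr_eq0//; apply/eqP; rewrite -subr_eq0 -rhoE; apply/eqP; ring.
      by rewrite -disc QE /v1; field.
    have v2E : v2 y * (v2 y - 3 * P.[y]) ^+ 2 = - 4 * (y ^+ k.+1 * D.[y]).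
      set H := h y ^+ k.+1 in hE; set Y := y ^+ k.+1 in hE *.
      have DE : D.[y] = - (H * (4 * Y * H - 9 * P.[y]) ^+ 2) / 27.
        apply: (mulIf (_ : 27 != 0 :> K)); first by rewrite pnatr_eq0.
        by rewrite divfK ?pnatr_eq0//; apply/eqP; rewrite -subr_eq0 -hE; apply/eqP; ring.
      by rewrite DE /v2 exprMn -/H -/Y; field.
    have -> : (v1 y - v2 y) * B y = v1 y * (v1 y - 3 * P.[y]) ^+ 2
        - v2 y * (v2 y - 3 * P.[y]) ^+ 2 by rewrite /B; ring.
    by rewrite v1E v2E subrr.
  have -> : (y * h y + 0 * (x - c)) ^+ k.+1 = 3 / 4 * (4 * P.[y] - rho y ^+ 2).
    by rewrite mul0r addr0 -/(v1 y) v12 /v2; field.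
  apply/eqP; rewrite -subr_eq0 -rhoE; apply/eqP; field.
Unshelve. all: by end_near. Qed.

(** * Upper bound *)

Section LocalForm.
Variable K : numFieldType.

Definition translate (F : {poly {poly K}}) (s : K * K) : {poly {poly K}} :=
  map_poly (comp_poly ('X + s.2%:P)) (F \Po ('X + s.1%:P%:P)).

Lemma horner_translate F s x y : (translate F s).[x, y] = F.[s.1 + x, s.2 + y].
Proof.
rewrite /translate.
have -> : x%:P = comp_poly ('X + s.2%:P) x%:P by rewrite comp_polyC.
rewrite horner_map/= horner_comp !hornerE horner_comp !hornerE [y + _]addrC.
by rewrite -polyCD [x + _]addrC.
Qed.

Lemma expands_at0 (f : K * K -> K) s c : expands f s c -> f s = c 0%N 0%N.
Proof.
move=> /(expands_jet 1)[C [r [r0 /(_ 0 0 0 r0)]]].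
rewrite normr0 => /(_ (lexx _) (lexx _)); rewrite expr1 mulr0 normr_le0 subr_eq0.
rewrite horner_jet !big_ord1 !expr0 !mulr1 !addr0 => /eqP <-.
by case: s.
Qed.

Lemma coef_jet (c : nat -> nat -> K) N i j : (i < N)%N -> (j < N)%N ->
  (jet c N)`_i`_j = c i j.
Proof. by move=> iN jN; rewrite /jet coef_poly iN coef_poly jN. Qed.

(** [small_order_ord] gives [R] formal order N; the later choice N = k + 2 makes [R] negligible
    against U^(k+1). *)
Lemma local_form (F : {poly {poly K}}) s k N : (0 < k)%N -> (1 < N)%N -> type_A F s k ->
  exists U V E R : {poly {poly K}},
  [/\ translate F s = E * (V ^+ 2 - U ^+ k.+1) + R, ord_ge N R, E`_0`_0 != 0,
      U`_0`_0 = 0 /\ V`_0`_0 = 0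
    & U`_1`_0 * V`_0`_1 - U`_0`_1 * V`_1`_0 != 0].
Proof.
case: k => // k _ N1 [U [V [E [[u [v [Uu Vv U0 V0 jac]]] [e Ee] E0 FE]]]].
have N0 : (0 < N)%N by exact: ltnW.
exists (jet u N), (jet v N), (jet e N).
exists (translate F s - jet e N * (jet v N ^+ 2 - jet u N ^+ k.+2)).
split; rewrite ?coef_jet//.
- by rewrite addrC subrK.
- apply: small_order_ord.
  have := approxM (expands_jet N Ee)
    (approxB (approxX 2 (expands_jet N Vv)) (approxX k.+2 (expands_jet N Uu))).
  have /nbhs_ballP[d/= d0 FEd] := FE.
  apply: (small_order_near d0) => x y xd yd.
  rewrite -(FEd (s.1 + x, s.2 + y)); last first.
    by split; rewrite /= -ball_normE/= opprD addNKr normrN.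
  by rewrite !hornerD !hornerN horner_translate.
- by rewrite -(expands_at0 Ee).
- by rewrite -(expands_at0 Uu) -(expands_at0 Vv).
Qed.

End LocalForm.

Section XDivisibility.
Variable K : fieldType.
Implicit Types p q : {poly K}.

Lemma dvdX_horner0 p : ('X %| p) = (p.[0] == 0).
Proof. by rewrite -['X]subr0 dvdp_XsubCl. Qed.

Lemma dvdXn_mull n p q : p.[0] != 0 -> ('X^n %| p * q) = ('X^n %| q).
Proof.
by move=> p0; apply: Gauss_dvdpr; apply: coprimep_expl; rewrite coprimep_sym coprimepX.
Qed.

Lemma dvdXn_le m n p : (m <= n)%N -> 'X^n %| p -> 'X^m %| p.
Proof. by move=> mn; apply: dvdp_trans; exact: dvdp_exp2l. Qed.

Lemma dvdXn_sqr n p : 'X^(n.*2.+1) %| p ^+ 2 -> 'X^(n.+1) %| p.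
Proof.
elim: n p => [|n IH] p.
  by rewrite !expr1 !dvdX_horner0 horner_exp expf_eq0.
move=> Xp2; have : 'X %| p ^+ 2 by rewrite -['X]expr1; apply: dvdXn_le Xp2.
rewrite dvdX_horner0 horner_exp expf_eq0/= -dvdX_horner0 => /dvdpP[q qE].
move: Xp2; have -> : (n.+1.*2.+1 = n.*2.+1 + 2)%N by rewrite addn2.
rewrite qE exprMn exprD dvdp_mul2r ?expf_neq0 ?polyX_eq0// => /IH Xq.
by rewrite exprSr dvdp_mul2r ?polyX_eq0.
Qed.

End XDivisibility.

Lemma horner_addr_dvd (R : idomainType) (P : {poly {poly R}}) (x d : {poly R}) :
  d ^+ 2 %| P.[x + d] - P.[x] - P^`().[x] * d.
Proof.
elim/poly_ind: P => [|P c IH].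
  by rewrite deriv0 !horner0 mul0r !subr0 dvdp0.
rewrite derivMXaddC !hornerMXaddC hornerD hornerMX.
have -> : P.[x + d] * (x + d) + c - (P.[x] * x + c) - (P.[x] + P^`().[x] * x) * d
  = (P.[x + d] - P.[x] - P^`().[x] * d) * (x + d) + P^`().[x] * d ^+ 2 by ring.
by apply: dvdp_add; [exact: dvdp_mulr|exact: dvdp_mull].
Qed.

(** * Orders of vanishing along arcs *)

Section BivariateOrder.
Variable K : numFieldType.
Implicit Types (P G U V E R : {poly {poly K}}) (xi : {poly K}).

Lemma ord_ge_horner N P xi : ord_ge N P -> 'X %| xi -> 'X^N %| P.[xi].
Proof.
move=> ordP /dvdpP[w ->]; rewrite horner_coef.
elim/big_ind: _ => [|p q Xp Xq|i _]; [exact: dvdp0|exact: dvdp_add|].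
have /dvdpP[q ->] : 'X^(N - i) %| P`_i.
  rewrite -(poly_take_drop (N - i) P`_i) dvdp_add ?dvdp_mull//.
  suff -> : take_poly (N - i) P`_i = 0 by exact: dvdp0.
  apply/polyP => j; rewrite coef_take_poly coef0; case: ifP => // jN.
  by rewrite ordP// -ltn_subRL.
rewrite exprMn mulrACA -exprD dvdp_mull//.
by rewrite dvdp_exp2l//; lia.
Qed.

Lemma ord_ge_deriv N P : ord_ge N P -> ord_ge N.-1 P^`().
Proof.
move=> ordP i j ijN; rewrite coef_deriv coefMn ordP ?mul0rn//.
by case: N ordP ijN => // N _; rewrite addSn ltnS.
Qed.

Lemma ord_ge_swapXY N P : ord_ge N P -> ord_ge N (swapXY P).
Proof. by move=> ordP i j ijN; rewrite coef_swapXY ordP// addnC. Qed.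

Lemma coef0_horner P xi : xi`_0 = 0 -> P.[xi]`_0 = P`_0`_0.
Proof.
move=> xi0; elim/poly_ind: P => [|P c _]; first by rewrite horner0 !coef0.
by rewrite hornerMXaddC !coefD [(_ * xi)`_0]coef0M xi0 mulr0 coefMX coefC/= ?coef0 !add0r.
Qed.

Lemma coef1_horner P xi : xi`_0 = 0 -> P.[xi]`_1 = P`_0`_1 + P`_1`_0 * xi`_1.
Proof.
move=> xi0; elim/poly_ind: P => [|P c _]; first by rewrite horner0 !coef0 mul0r addr0.
rewrite hornerMXaddC !coefD !coefMX !coefC/= !add0r addr0 addrC; congr (_ + _).
have -> : (P.[xi] * xi)`_1 = P.[xi]`_0 * xi`_1 + P.[xi]`_1 * xi`_0.
  by rewrite coefM !big_ord_recl big_ord0 addr0.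
by rewrite xi0 mulr0 addr0 coef0_horner.
Qed.

Lemma implicit_jet P N : P`_0`_0 = 0 -> P`_1`_0 != 0 ->
  exists2 xi, 'X %| xi & 'X^N %| P.[xi].
Proof.
move=> P0 P1; elim: N => [|N [xi Xxi /dvdpP[q qE]]].
  by exists 0; rewrite ?dvdp0// expr0 dvd1p.
have xi0 : xi`_0 = 0 by move: Xxi; rewrite dvdX_horner0 horner_coef0 => /eqP.
case: N qE => [|N] qE.
  exists xi => //; rewrite expr1 dvdX_horner0 horner_coef0 coef0_horner//.
  exact/eqP.
(* Hensel step: [d] cancels the coefficient of y^(N+1), and the quadratic Taylor error has order at
   least 2 (N + 1), hence at least N + 2. *)
pose d := - (q.[0] / P`_1`_0) *: 'X^(N.+1).
have Xd : 'X^(N.+1) %| d by rewrite /d -mul_polyC dvdp_mull.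
exists (xi + d); first by rewrite dvdp_add// (dvdp_trans _ Xd)// -{1}['X]expr1 dvdp_exp2l.
have := horner_addr_dvd P xi d.
set T := P.[xi + d] - P.[xi] - P^`().[xi] * d => XT.
have -> : P.[xi + d] = T + (P.[xi] + P^`().[xi] * d) by rewrite /T; ring.
rewrite dvdp_add//.
  apply: dvdp_trans XT; apply: dvdp_trans (dvdp_exp2r 2 Xd).
  by rewrite -exprM dvdp_exp2l// muln2 -addnn addSnnS leq_addl.
have -> : P.[xi] + P^`().[xi] * d
    = (q - (q.[0] / P`_1`_0) *: P^`().[xi]) * 'X^(N.+1).
  by rewrite qE /d -!mul_polyC polyCN; ring.
rewrite exprS dvdp_mul// dvdX_horner0 !hornerE [_.[xi].[0]]horner_coef0.
by rewrite coef0_horner// coef_deriv mulr1n divfK// subrr.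
Qed.

End BivariateOrder.

Section JetIdentity.
Variables (K : numFieldType) (k : nat) (G U V E R : {poly {poly K}}).
Hypotheses (GE : G = E * (V ^+ 2 - U ^+ k.+1) + R) (ordR : ord_ge k.+2 R).
Hypotheses (E0 : E`_0`_0 != 0) (U0 : U`_0`_0 = 0) (V0 : V`_0`_0 = 0).
Hypothesis jac : U`_1`_0 * V`_0`_1 - U`_0`_1 * V`_1`_0 != 0.

(** Along an arc on which V vanishes to high order, the Jacobian condition gives U order exactly 1,
    so G has order exactly k + 1; its x-derivative keeps order at least k because V enters squared
    and U to the power k + 1. *)
Lemma jet_transversal : (1 < k)%N -> V`_1`_0 != 0 -> exists xi B : {poly K},
  [/\ 'X %| xi, G.[xi] = B * 'X^(k.+1), B.[0] != 0, 'X^k %| G^`().[xi]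
    & G`_2`_0 != 0].
Proof.
move=> k1 V1; have [xi Xxi XV] := implicit_jet k.+2 V0 V1.
have xi0 : xi`_0 = 0 by move: Xxi; rewrite dvdX_horner0 horner_coef0 => /eqP.
have XU : 'X %| U.[xi].
  by rewrite dvdX_horner0 horner_coef0 coef0_horner// U0.
have /dvdpP[w wE] := XU.
have w0 : w.[0] != 0.
  have wU : w`_0 = U.[xi]`_1 by rewrite wE coefMX.
  have V1xi : V.[xi]`_1 = 0 by have /dvdpP[q ->] := XV; rewrite coefMXn.
  rewrite horner_coef0 wU coef1_horner//; move: V1xi; rewrite coef1_horner// => V1xi.
  apply: contraNneq jac => U1xi; apply/eqP.
  have -> : U`_1`_0 * V`_0`_1 - U`_0`_1 * V`_1`_0
      = U`_1`_0 * (V`_0`_1 + V`_1`_0 * xi`_1)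
        - (U`_0`_1 + U`_1`_0 * xi`_1) * V`_1`_0 by ring.
  by rewrite V1xi U1xi mulr0 mul0r subrr.
have [v vE] := dvdpP _ _ XV; have [r rE] := dvdpP _ _ (ord_ge_horner ordR Xxi).
exists xi, (E.[xi] * (v ^+ 2 * 'X^(k.+3) - w ^+ k.+1) + r * 'X); split=> //.
- rewrite GE hornerD hornerM hornerD hornerN !horner_exp vE wE rE exprMn [(w * 'X) ^+ _]exprMn -exprM.
  have -> : (k.+2 * 2 = k.+3 + k.+1)%N by (move: k1; clear; lia).
  by rewrite exprD [in r * _]exprS; ring.
- rewrite hornerD hornerMX mulr0 addr0 hornerM hornerD hornerN !horner_exp hornerM hornerXn.
  rewrite expr0n mulr0 sub0r mulf_neq0//.
    by rewrite horner_coef0 coef0_horner.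
  by rewrite oppr_eq0 expf_neq0.
- have XkV : 'X^k %| V.[xi] by apply: dvdXn_le XV; (move: k1; clear; lia).
  have XkU : 'X^k %| U.[xi] ^+ k by exact: dvdp_exp2r.
  have XkR : 'X^k %| R^`().[xi].
    by apply: (@dvdXn_le _ _ k.+1) => //; exact: ord_ge_horner (ord_ge_deriv ordR) Xxi.
  have -> : G^`().[xi] = E^`().[xi] * (V.[xi] * V.[xi] - U.[xi] * U.[xi] ^+ k)
      + E.[xi] * (2 * V^`().[xi] * V.[xi] - k.+1%:R * U^`().[xi] * U.[xi] ^+ k)
      + R^`().[xi].
    rewrite GE !derivE !deriv_exp hornerD hornerD !hornerM !hornerD !hornerN.
    rewrite !hornerMn !hornerM !horner_exp/= exprS -[_ *+ k.+1]mulr_natl; ring.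
  by rewrite dvdp_add// dvdp_add// dvdp_mull// dvdp_sub// dvdp_mull.
(* Restriction to y = 0: as k > 1, U^(k+1) has no term in x^2, so the coefficient of x^2 is E V_x^2
   at the origin. *)
- have e0 (P : {poly {poly K}}) i : (map_poly (horner_eval 0) P)`_i = P`_i`_0.
    by rewrite coef_map/= /horner_eval horner_coef0.
  have := congr1 (map_poly (horner_eval (0 : K))) GE.
  rewrite rmorphD rmorphM rmorphB !rmorphXn/=.
  have /dvdpP[v' v'E] : 'X %| map_poly (horner_eval 0) V.
    by rewrite dvdX_horner0 horner_coef0 e0 V0.
  have /dvdpP[u' u'E] : 'X %| map_poly (horner_eval 0) U.
    by rewrite dvdX_horner0 horner_coef0 e0 U0.
  move=> /(congr1 (fun p : {poly K} => p`_2)); rewrite e0 coefD e0.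
  rewrite ordR//; last by (move: k1; clear; lia).
  rewrite v'E u'E !exprMn.
  have -> : u' ^+ k.+1 * 'X^(k.+1) = u' ^+ k.+1 * 'X^(k.-1) * 'X^2.
    by rewrite -mulrA -exprD; congr (_ * 'X^_); (move: k1; clear; lia).
  rewrite -mulrBl mulrA coefMXn/= addr0 coef0M e0 => ->.
  have v'0 : v'`_0 = V`_1`_0 by rewrite -e0 v'E coefMX.
  have -> : (v' ^+ 2 - u' ^+ k.+1 * 'X^(k.-1))`_0 = v'`_0 ^+ 2.
    by rewrite coefB coefMXn ltn_predRL k1 subr0 expr2 coef0M.
  by rewrite v'0 mulf_neq0// expf_neq0.
Qed.

(* Otherwise F(x, 0) has order at least 4 and F_y(x, 0) order at least 3, so both
   vanish identically; the second fact then gives V(x, 0) order at least k, the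
   first one V(x, 0)^2 order k + 1. *)
Lemma jet_not_vertical : (3 < k)%N -> (size G <= 4)%N ->
  (forall i j, (2 < i)%N -> (0 < j)%N -> G`_i`_j = 0) -> V`_1`_0 != 0.
Proof.
move=> k3 G4 G3; apply/negP => /eqP V1.
(* After the swap, evaluation at 0 of a polynomial and of its derivative gives the restrictions to y
   = 0 of G and of its y-derivative, as polynomials in x. *)
have SE : swapXY G = swapXY E * (swapXY V ^+ 2 - swapXY U ^+ k.+1) + swapXY R.
  by rewrite GE rmorphD rmorphM rmorphB !rmorphXn.
have SR := ord_ge_swapXY ordR.
pose sG := swapXY G; pose sE := swapXY E; pose sU := swapXY U.
pose sV := swapXY V; pose sR := swapXY R.
have X0 : 'X %| (0 : {poly K}) by exact: dvdp0.
have XR0 : 'X^(k.+2) %| sR.[0] by exact: ord_ge_horner SR X0.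
have XR1 : 'X^(k.+1) %| sR^`().[0] by exact: ord_ge_horner (ord_ge_deriv SR) X0.
have g0E : sG.[0] = sE.[0] * (sV.[0] ^+ 2 - sU.[0] ^+ k.+1) + sR.[0].
  by rewrite /sG SE hornerD hornerM hornerD hornerN !horner_exp.
have g1E : sG^`().[0] = sE^`().[0] * (sV.[0] ^+ 2 - sU.[0] ^+ k.+1)
    + sE.[0] * (2 * sV.[0] * sV^`().[0] - k.+1%:R * sU.[0] ^+ k * sU^`().[0])
    + sR^`().[0].
  rewrite /sG SE !derivE !deriv_exp hornerD hornerD !hornerM !hornerD !hornerN.
  rewrite !hornerMn !hornerM !horner_exp/= exprS -[_ *+ k.+1]mulr_natl; ring.
have coef_s0 (P : {poly {poly K}}) i : (swapXY P).[0]`_i = P`_i`_0.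
  by rewrite horner_coef0 coef_swapXY.
have coef_s1 (P : {poly {poly K}}) i : (swapXY P)^`().[0]`_i = P`_i`_1.
  by rewrite horner_coef0 coef_deriv mulr1n coef_swapXY.
move: (coef_s0 G) (coef_s1 G) (coef_s0 E) (coef_s0 U) (coef_s0 V) (coef_s1 V).
rewrite -/sG -/sE -/sU -/sV => G_s0 G_s1 E_s0 U_s0 V_s0 V_s1.
clearbody sG sE sU sV sR; clear coef_s0 coef_s1.
have XU : 'X %| sU.[0] by rewrite dvdX_horner0 horner_coef0 U_s0 U0.
have X2V : 'X^2 %| sV.[0].
  have /dvdpP[w wE] : 'X %| sV.[0] by rewrite dvdX_horner0 horner_coef0 V_s0 V0.
  rewrite wE exprSr expr1 dvdp_mul2r ?polyX_eq0// dvdX_horner0 horner_coef0.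
  by have := V_s0 1; rewrite wE coefMX/= V1 => ->.
have small_poly n (p : {poly K}) : 'X^n %| p -> (forall i, (n <= i)%N -> p`_i = 0) -> p = 0.
  move=> /dvdpP[q ->] p0; apply/polyP => i; rewrite coef0.
  by have [/p0//|lt] := leqP n i; rewrite coefMXn lt.
have X4V2 : 'X^4 %| sV.[0] ^+ 2 by rewrite (exprM 'X 2 2) dvdp_exp2r.
have XkU m n : (m <= n)%N -> 'X^m %| sU.[0] ^+ n.
  by move=> mn; apply: (dvdXn_le mn); exact: dvdp_exp2r.
have g0 : sG.[0] = 0.
  apply: (small_poly 4%N) => [|i i4]; last first.
    by rewrite G_s0 [G`_i]nth_default ?coef0 ?(leq_trans G4).
  rewrite g0E; apply: dvdp_add; last by apply: dvdXn_le XR0; (move: k3; clear; lia).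
  by apply: dvdp_mull; apply: dvdp_sub; [exact: X4V2|apply: XkU; (move: k3; clear; lia)].
have sE0 : sE.[0].[0] != 0 by rewrite horner_coef0 E_s0.
have XVU : 'X^(k.+2) %| sV.[0] ^+ 2 - sU.[0] ^+ k.+1.
  rewrite -(dvdXn_mull _ _ sE0) -[_ * _](addrK sR.[0]) -g0E g0 sub0r.
  by rewrite -scaleN1r dvdpZr ?oppr_eq0 ?oner_eq0.
(* Since k > 3, x^5 divides V(x, 0)^2; a square has even order, which improves the order of V(x, 0)
   from 2 to 3. *)
have X3V : 'X^3 %| sV.[0].
  apply: (@dvdXn_sqr _ 2%N); rewrite -[_ ^+ 2](subrK (sU.[0] ^+ k.+1)).
  by apply: dvdp_add; [apply: dvdXn_le XVU; (move: k3; clear; lia)|apply: XkU; (move: k3; clear; lia)].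
have g1 : sG^`().[0] = 0.
  apply: (small_poly 3%N) => [|i i3]; last by rewrite G_s1 G3.
  rewrite g1E; apply: dvdp_add; last by apply: dvdXn_le XR1; (move: k3; clear; lia).
  apply: dvdp_add; first by apply: dvdp_mull; apply: dvdXn_le XVU; (move: k3; clear; lia).
  apply: dvdp_mull; apply: dvdp_sub.
    by rewrite mulrAC; apply: dvdp_mull; exact: X3V.
  by rewrite mulrAC; apply: dvdp_mull; apply: XkU; (move: k3; clear; lia).
(* With V_x = 0 at the origin, the Jacobian condition leaves V_y nonzero there, so the vanishing of
   the y-derivative determines V(x, 0) modulo x^k. *)
have XkV : 'X^k %| sV.[0].
  have sV1 : sV^`().[0].[0] != 0.
    rewrite horner_coef0 V_s1; apply: contraNneq jac => V01.
    by rewrite V01 V1 !mulr0 subrr.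
  have c0 : (sE.[0] * 2 * sV^`().[0]).[0] != 0.
    by rewrite !hornerM !mulf_neq0// -polyC_natr hornerC pnatr_eq0.
  rewrite -(dvdXn_mull _ _ c0).
  have -> : sE.[0] * 2 * sV^`().[0] * sV.[0] = sG^`().[0]
      - sE^`().[0] * (sV.[0] ^+ 2 - sU.[0] ^+ k.+1)
      + sE.[0] * k.+1%:R * sU^`().[0] * sU.[0] ^+ k - sR^`().[0].
    by rewrite g1E; ring.
  rewrite g1 sub0r; apply: dvdp_sub; last by apply: dvdXn_le XR1; (move: k3; clear; lia).
  apply: dvdp_add; last by apply: dvdp_mull; exact: XkU.
  rewrite -scaleN1r dvdpZr ?oppr_eq0 ?oner_eq0//.
  by apply: dvdp_mull; apply: dvdXn_le XVU; (move: k3; clear; lia).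
(* As 2 k >= k + 2, U(x, 0)^(k+1) has order at least k + 2, so U_x vanishes at the origin together
   with V_x, against the Jacobian condition. *)
have XU2 : 'X^(k.+2) %| sU.[0] ^+ k.+1.
  rewrite -[_ ^+ k.+1](subKr (sV.[0] ^+ 2)); apply: dvdp_sub; last exact: XVU.
  apply: (@dvdp_trans _ ('X^k ^+ 2)); last exact: dvdp_exp2r.
  by rewrite -exprM dvdp_exp2l//; (move: k3; clear; lia).
have /dvdpP[w wE] := XU; move: XU2; rewrite wE exprMn exprS.
rewrite dvdp_mul2r ?expf_neq0 ?polyX_eq0// dvdX_horner0 horner_exp expf_eq0/=.
rewrite horner_coef0; have := U_s0 1; rewrite wE coefMX/= => -> /eqP U1.
by move: jac; rewrite U1 V1 mul0r mulr0 subrr eqxx.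
Qed.

End JetIdentity.

(** * Degree bound for the contact of a square and a cube *)

Section WronskianBound.
Variable K : numFieldType.
Implicit Types p q B : {poly K}.

Lemma coefM_top p q m n : (size p <= m.+1)%N -> (size q <= n.+1)%N ->
  (p * q)`_(m + n) = p`_m * q`_n.
Proof.
move=> pm qn; have mn : (m < (m + n).+1)%N by rewrite ltnS leq_addr.
rewrite coefM (bigD1 (Ordinal mn))//= addKn big1 ?addr0// => i im.
have [lt|ge] := ltnP i m.
  by rewrite [q`_ _]nth_default ?mulr0// (leq_trans qn)//; lia.
rewrite [p`_ _]nth_default ?mul0r// (leq_trans pm)// ltn_neqAle ge andbT.
by rewrite eq_sym.
Qed.

(* D' p - 3 D p' = q (2 p q' - 3 p' q) for D = q ^ 2 - 4 p ^ 3, so a zero of D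
   of order k + 1 forces one of order k on the Wronskian-like factor. *)
Lemma wronskian_dvd p q B k : q ^+ 2 - 4 * p ^+ 3 = B * 'X^(k.+1) ->
  p.[0] != 0 -> q.[0] != 0 -> B.[0] != 0 ->
  'X^k %| 2 * p * q^`() - 3 * p^`() * q /\ 2 * p * q^`() - 3 * p^`() * q != 0.
Proof.
move=> DE p0 q0 B0; set W := _ - _.
have qW : q * W = (B^`() * p * 'X + k.+1%:R * B * p - 3 * B * 'X * p^`()) * 'X^k.
  have dD := congr1 deriv DE.
  have -> : q * W = (q ^+ 2 - 4 * p ^+ 3)^`() * p - 3 * (q ^+ 2 - 4 * p ^+ 3) * p^`().
    have d4 : (4 : {poly K})^`() = 0 by rewrite -polyC_natr derivC.
    by rewrite derivB [(4 * _)^`()]derivM d4 mul0r add0r !deriv_exp /W/=; ring.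
  by rewrite DE derivM derivXn/= -mulr_natl exprS; ring.
split; first by rewrite -(dvdXn_mull _ _ q0) qW dvdp_mull.
apply/eqP => W0; move: qW; rewrite W0 mulr0 => /esym/eqP.
rewrite mulf_eq0 expf_eq0 polyX_eq0 andbF orbF => /eqP/(congr1 (horner^~ 0)).
rewrite hornerD hornerN hornerD horner0 !hornerM hornerX !mulr0 add0r mul0r subr0.
by apply/eqP; rewrite !mulf_neq0// -polyC_natr hornerC pnatr_eq0.
Qed.

(** When 3 divides b, reversing the polynomials turns this into Davenport's lower bound for the
    degree of f^3 - g^2. *)
Lemma discriminant_order_bound p q B b k : (2 < b)%N ->
  (3 * (size p).-1 <= 2 * b)%N -> ((size q).-1 <= b)%N ->
  q ^+ 2 - 4 * p ^+ 3 = B * 'X^(k.+1) ->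
  p.[0] != 0 -> q.[0] != 0 -> B.[0] != 0 -> (3 * k + 4 <= 5 * b)%N.
Proof.
move=> b2 sp sq DE p0 q0 B0; have [XW Wn0] := wronskian_dvd DE p0 q0 B0.
set W := _ - _ in XW Wn0.
have sW : (k < size W)%N by have := dvdp_leq Wn0 XW; rewrite size_polyXn.
pose m := ((2 * b) %/ 3)%N.
have sp' : (size p <= m.+1)%N by rewrite /m; lia.
have sq' : (size q <= b.+1)%N by lia.
have sdp : (size p^`() <= m)%N.
  by have := size_poly (size p).-1 (fun i => p`_i.+1 *+ i.+1); rewrite /deriv /m; lia.
have sdq : (size q^`() <= b)%N.
  by have := size_poly (size q).-1 (fun i => q`_i.+1 *+ i.+1); rewrite /deriv; lia.
have W_le : (size W <= m + b)%N.
  apply/leq_sizeP => j mbj.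
  have cz (u v : {poly K}) : (size u + size v <= j.+1)%N -> (u * v)`_j = 0.
    move=> suv; rewrite nth_default//; apply: leq_trans (size_mul_leq u v) _.
    by rewrite -subn1 leq_subLR add1n.
  rewrite /W coefB -!mulrA -!polyC_natr !coefCM !cz ?mulr0 ?subr0//; lia.
(* If 3 does not divide b, rounding 2 b / 3 down already gives the bound. Otherwise m = 2 b / 3
   exactly, and the top coefficient carries the factor 2 b - 3 m = 0. *)
have [b3|b3] := boolP (3 %| b)%N; last by rewrite /m in W_le; lia.
have mb : W`_(m + b).-1%N = 0.
  have -> : (m + b).-1%N = (m.-1 + b)%N by rewrite /m; lia.
  rewrite /W coefB -!mulrA -!polyC_natr !coefCM [(p^`() * q)`_ _]coefM_top//; last first.
    by rewrite (leq_trans sdp)//; rewrite /m; lia.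
  have -> : (m.-1 + b = m + b.-1)%N by rewrite /m; lia.
  have bE : b.-1.+1 = b by lia.
  rewrite coefM_top ?bE// !coef_deriv.
  have -> : m.-1.+1 = m by rewrite /m; lia.
  rewrite bE.
  rewrite -[_ *+ b]mulr_natr -[_ *+ m]mulr_natr.
  have -> : 2 * (p`_m * (q`_b * b%:R)) - 3 * (p`_m * m%:R * q`_b)
    = p`_m * q`_b * ((2 * b)%:R - (3 * m)%:R) by rewrite !natrM; ring.
  have -> : (3 * m = 2 * b)%N by rewrite /m; lia.
  by rewrite subrr mulr0.
have : (size W <= (m + b).-1)%N.
  apply/leq_sizeP => j; rewrite leq_eqVlt => /predU1P[<-//|lt].
  by rewrite nth_default// (leq_trans W_le); lia.
by rewrite /m; lia.
Qed.

End WronskianBound.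

(** * Degrees of the seminvariants and the bound on k *)

Section UpperBound.
Variable K : numFieldType.
Implicit Types (F : {poly {poly K}}) (p q : {poly K}).

Definition deg_le (n : nat) p := (size p <= n.+1)%N.

Lemma deg_leM m n p q : deg_le m p -> deg_le n q -> deg_le (m + n) (p * q).
Proof.
rewrite /deg_le => pm qn; apply: leq_trans (size_mul_leq p q) _.
by rewrite -subn1 leq_subLR add1n -addnS -addSn leq_add.
Qed.

Lemma deg_leB n p q : deg_le n p -> deg_le n q -> deg_le n (p - q).
Proof.
rewrite /deg_le => pn qn; apply: leq_trans (size_polyD _ _) _.
by rewrite size_polyN geq_max pn.
Qed.

Lemma deg_leD n p q : deg_le n p -> deg_le n q -> deg_le n (p + q).
Proof.
rewrite /deg_le => pn qn; apply: leq_trans (size_polyD _ _) _.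
by rewrite geq_max pn.
Qed.

Lemma deg_le_nat m : deg_le 0 m%:R.
Proof. by rewrite /deg_le -polyC_natr size_polyC_leq1. Qed.

Lemma deg_leW m n p : (m <= n)%N -> deg_le m p -> deg_le n p.
Proof. by move=> mn /leq_trans; apply; rewrite ltnS. Qed.

Lemma bidegree_coef b F i : has_bidegree 3 b F -> deg_le ((b * (3 - i)) %/ 3) F`_i.
Proof.
move=> [_ Fb]; apply/leq_sizeP => j ij; apply/eqP; apply: contraTT ij => Fij.
have /and3P[i3 jb tri] := Fb _ _ Fij; rewrite -leqNgt leq_divRL//.
by move: tri; rewrite mulnBr; move: (b * i)%N => m; lia.
Qed.

Lemma bidegree_size b F : has_bidegree 3 b F -> (size F <= 4)%N.
Proof.
move=> [_ Fb]; apply/leq_sizeP => i i4; apply/polyP => j; rewrite coef0; apply/eqP.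
by apply: contraTT i4 => /Fb/and3P[i3 _ _]; rewrite -ltnNge ltnS.
Qed.

Lemma size4_Poly (T : nzRingType) (P : {poly T}) : (size P <= 4)%N ->
  P = Poly [:: P`_0; P`_1; P`_2; P`_3].
Proof.
move=> sP; apply/polyP => i; rewrite coef_Poly.
by case: i => [|[|[|[|i]]]] //=; rewrite nth_default ?nth_nil// (leq_trans sP).
Qed.

Lemma translate_coefs F s : (size F <= 4)%N ->
  let h i := F`_i \Po ('X + s.2%:P) in let c := s.1%:P in
  translate F s = Poly [:: h 0%N + h 1%N * c + h 2%N * c ^+ 2 + h 3%N * c ^+ 3;
    h 1%N + 2 * h 2%N * c + 3 * h 3%N * c ^+ 2; h 2%N + 3 * h 3%N * c; h 3%N].
Proof.
move=> sF h c; rewrite /translate [in LHS](size4_Poly sF).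
rewrite /= !cons_poly_def !(comp_polyD, comp_polyM, comp_polyX, comp_polyC).
rewrite !(rmorphD, rmorphM)/= !map_polyC !map_polyX/= comp_polyC -/c !polyC0.
rewrite -!/(h _) !rmorph0; ring.
Qed.

(* Shifting x does not change the seminvariants p = a2^2 - 3 a1 a3 and
   q = 2 a2^3 - 9 a1 a2 a3 + 27 a0 a3^2 of a cubic, for which
   q^2 - 4 p^3 = - 27 a3^2 disc; when a3 = 0 the discriminant of the quadratic
   plays the same role. *)
Lemma type_A_bound b k F s : (2 < b)%N -> has_bidegree 3 b F -> type_A F s k ->
  (3 * k + 4 <= 5 * b)%N.
Proof.
move=> b2 Fb Fk; have [k3|k4] := leqP k 3.
  (* For k <= 3 the bound is free: 3 k + 4 <= 13 and 5 b >= 15. *)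
  by have := leq_mul (leqnn 3) k3; lia.
have sF := bidegree_size Fb.
have k0 : (0 < k)%N by exact: leq_trans k4.
have k1 : (1 < k)%N by exact: leq_trans k4.
have [U [V [E [R [GE ordR E0 [U0 V0] jac]]]]] := @local_form K F s k k.+2 k0 isT Fk.
move: (translate_coefs s sF); cbv zeta.
set h := (fun i : nat => F`_i \Po _); set c := s.1%:P => GP.
have h_deg i : deg_le ((b * (3 - i)) %/ 3) (h i).
  rewrite /deg_le /h size_comp_poly2 ?size_XaddC//; exact: bidegree_coef Fb.
have h3C : h 3%N = ((h 3%N)`_0)%:P.
  by apply: size1_polyC; have := h_deg 3%N; rewrite subnn muln0 div0n.
have sG : (size (translate F s) <= 4)%N by rewrite GP; exact: size_Poly.
have G3 i j : (2 < i)%N -> (0 < j)%N -> (translate F s)`_i`_j = 0.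
  case: i => [|[|[|[|i]]]]// _ j0; rewrite GP coef_Poly/=.
    by rewrite h3C coefC -if_neg -lt0n j0.
  by rewrite nth_nil coef0.
have V1 := jet_not_vertical GE ordR E0 U0 V0 jac k4 sG G3.
have [xi [B [Xxi A0E B0 XA1 A2]]] := jet_transversal GE ordR E0 U0 V0 jac k1 V1.
have [A A1E] := dvdpP _ _ XA1.
(* [eta] is the arc in the unshifted coordinate x. The Taylor coefficients of the cubic there are B
   y^(k+1), A y^k, C and h 3, from which [p] and [q] can be computed by invariance. *)
pose eta := c + xi.
have xi0 : xi.[0] = 0 by move: Xxi; rewrite dvdX_horner0 => /eqP.
have h0E : B * 'X^(k.+1) = h 0%N + h 1%N * eta + h 2%N * eta ^+ 2 + h 3%N * eta ^+ 3.
  by rewrite -A0E GP horner_Poly /= /eta; ring.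
have h1E : A * 'X^k = h 1%N + 2 * h 2%N * eta + 3 * h 3%N * eta ^+ 2.
  rewrite -A1E GP /= !cons_poly_def !derivMXaddC derivC mul0r addr0.
  by rewrite !(hornerD, hornerM, hornerX, hornerC) /eta; ring.
pose C := h 2%N + 3 * h 3%N * eta.
have C0 : C.[0] != 0.
  rewrite /C /eta mulrDr addrA hornerD [(_ * xi).[0]]hornerM xi0 mulr0 addr0.
  by move: A2; rewrite GP coef_Poly/= horner_coef0.
have kE : 'X^k = 'X^(k.-1) * 'X :> {poly K} by rewrite -exprSr prednK.
have k1E : 'X^(k.+1) = 'X^(k.-1) * 'X * 'X :> {poly K} by rewrite -kE -exprSr.
have [h3|h3] := eqVneq (h 3%N) 0.
  have CE : C = h 2%N by rewrite /C h3 mulr0 mul0r addr0.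
  (* For a quadratic in x, k + 1 is at most the degree of its discriminant, hence at most 4 b / 3,
     which suffices. *)
  have dE : (A ^+ 2 * 'X^(k.-1) - 4 * C * B) * 'X^(k.+1)
      = h 1%N ^+ 2 - 4 * h 0%N * h 2%N.
    have -> : (A ^+ 2 * 'X^(k.-1) - 4 * C * B) * 'X^(k.+1)
        = (A * 'X^k) ^+ 2 - 4 * C * (B * 'X^(k.+1)) by rewrite k1E kE; ring.
    by rewrite h0E h1E CE h3; ring.
  set T := _ - _ in dE.
  have T0 : T != 0.
    apply: contraNneq C0 => /(congr1 (horner^~ 0)); rewrite hornerD hornerN !hornerM.
    rewrite hornerXn expr0n -subn1 subn_eq0 leqNgt k1 mulr0 sub0r horner0 => /eqP.
    rewrite oppr_eq0 !mulf_eq0 (negPf B0) orbF -polyC_natr hornerC pnatr_eq0/=.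
    exact.
  have : deg_le ((4 * b) %/ 3) (h 1%N ^+ 2 - 4 * h 0%N * h 2%N).
    apply: deg_leB.
      by apply: deg_leW (deg_leM (h_deg 1%N) (h_deg 1%N)); clear; lia.
    by apply: deg_leW (deg_leM (deg_leM (deg_le_nat 4) (h_deg 0%N)) (h_deg 2%N)); (clear; lia).
  rewrite /deg_le -dE size_Mmonic ?monicXn// size_polyXn.
  have : (0 < size T)%N by rewrite size_poly_gt0.
  by move: (size T) b2 k4 => n; clear; lia.
pose p := h 2%N ^+ 2 - 3 * h 1%N * h 3%N.
pose q := 2 * h 2%N ^+ 3 - 9 * h 1%N * h 2%N * h 3%N + 27 * h 0%N * h 3%N ^+ 2.
have pE : p = C ^+ 2 - 3 * (A * 'X^k) * h 3%N by rewrite h1E /C /p; ring.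
have qE : q = 2 * C ^+ 3 - 9 * (A * 'X^k) * C * h 3%N + 27 * (B * 'X^(k.+1)) * h 3%N ^+ 2.
  by rewrite h0E h1E /C /q; ring.
(* The discriminant in terms of the Taylor coefficients at [eta], times - 27 h3^2 and divided by
   y^(k+1). Of the bracket only - 4 B C^3 survives at 0. *)
pose T := - 27 * h 3%N ^+ 2 * (A ^+ 2 * C ^+ 2 * 'X^(k.-1)
  - 4 * A ^+ 3 * h 3%N * 'X^(k.-1) * 'X^k + 18 * A * B * C * h 3%N * 'X^k
  - 27 * B ^+ 2 * h 3%N ^+ 2 * 'X^(k.+1) - 4 * B * C ^+ 3).
have nat0 (n : nat) : (n%:R : {poly K}).[0] = n%:R by rewrite -polyC_natr hornerC.
have h3n0 : (h 3%N).[0] != 0 by rewrite h3C hornerC; rewrite h3C polyC_eq0 in h3.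
apply: (@discriminant_order_bound K p q T b k b2).
- have p_deg : deg_le ((2 * b) %/ 3) p.
    apply: deg_leB.
      by apply: deg_leW (deg_leM (h_deg 2%N) (h_deg 2%N)); clear; lia.
    by apply: deg_leW (deg_leM (deg_leM (deg_le_nat 3) (h_deg 1%N)) (h_deg 3%N)); clear; lia.
  by move: p_deg; rewrite /deg_le; move: (size p) => n; clear; lia.
- have q_deg : deg_le b q.
    apply: deg_leD; first apply: deg_leB.
    + apply: deg_leW (deg_leM (deg_le_nat 2) (deg_leM (h_deg 2%N)
        (deg_leM (h_deg 2%N) (h_deg 2%N)))); clear; lia.
    + apply: deg_leW (deg_leM (deg_leM (deg_leM (deg_le_nat 9) (h_deg 1%N))
        (h_deg 2%N)) (h_deg 3%N)); clear; lia.
    + apply: deg_leW (deg_leM (deg_leM (deg_le_nat 27) (h_deg 0%N))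
        (deg_leM (h_deg 3%N) (h_deg 3%N))); clear; lia.
  by move: q_deg; rewrite /deg_le; move: (size q) => n; clear; lia.
- by rewrite pE qE /T k1E kE; ring.
- have -> : p = C ^+ 2 + - (3 * A * 'X^(k.-1) * h 3%N) * 'X by rewrite pE kE; ring.
  by rewrite hornerD hornerMX mulr0 addr0 horner_exp expf_neq0.
- have -> : q = 2 * C ^+ 3 + (27 * B * 'X^k * h 3%N ^+ 2
      - 9 * A * 'X^(k.-1) * C * h 3%N) * 'X by rewrite qE k1E kE; ring.
  rewrite hornerD hornerMX mulr0 addr0 hornerM nat0 horner_exp.
  by rewrite mulf_neq0 ?expf_neq0// pnatr_eq0.
- have k2E : 'X^(k.-1) = 'X^(k.-2) * 'X :> {poly K}.
    by rewrite -exprSr prednK// -subn1 subn_gt0.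
  have -> : T = 108%:R * (h 3%N ^+ 2 * (B * C ^+ 3)) + (- 27 * h 3%N ^+ 2 *
      (A ^+ 2 * C ^+ 2 * 'X^(k.-2) - 4 * A ^+ 3 * h 3%N * 'X^(k.-2) * 'X^k
       + 18 * A * B * C * h 3%N * 'X^(k.-1)
       - 27 * B ^+ 2 * h 3%N ^+ 2 * 'X^k)) * 'X by rewrite /T k1E kE k2E; ring.
  rewrite hornerD hornerMX mulr0 addr0 hornerM nat0 !hornerM.
  by rewrite !mulf_neq0// pnatr_eq0.
Qed.

End UpperBound.

(** * Irreducibility *)

Section CubicFacts.
Variable K : numFieldType.
Implicit Types P Q D r : {poly K}.

Lemma cubic_Poly P Q : cubic P Q = Poly [:: 2 *: Q; - (3 *: P); 0; 1].
Proof. by rewrite /= !cons_poly_def /cubic polyCN !polyC0; ring. Qed.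

Lemma size_cubic P Q : size (cubic P Q) = 4%N.
Proof. by rewrite cubic_Poly (@PolyK _ 0) ?oner_eq0. Qed.

Lemma lead_coef_cubic P Q : lead_coef (cubic P Q) = 1.
Proof. by rewrite lead_coefE size_cubic cubic_Poly coef_Poly. Qed.

Lemma cubic_bidegree b P Q : deg_le ((2 * b) %/ 3) P -> deg_le b Q ->
  has_bidegree 3 b (cubic P Q).
Proof.
move=> degP degQ; split; first by rewrite -size_poly_eq0 size_cubic.
move=> i j; rewrite cubic_Poly coef_Poly /in_triangle.
case: i => [|[|[|[|i]]]]; rewrite /= ?nth_nil ?coef0 ?eqxx//.
- have [lt|ge] := ltnP j b.+1; first by move: lt; clear; lia.
  by rewrite coefZ [Q`_j]nth_default ?mulr0 ?eqxx// (leq_trans degQ).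
- have [lt|ge] := ltnP j ((2 * b) %/ 3).+1; first by move: lt; clear; lia.
  by rewrite coefN coefZ [P`_j]nth_default ?mulr0 ?oppr0 ?eqxx// (leq_trans degP).
- by rewrite coef1; case: j => [|j]; rewrite ?eqxx//= => _; clear; lia.
Qed.

(** If deg r > b / 3, then r^3 has larger degree than both P r and Q and cannot be cancelled. *)
Lemma deg_root_cubic b P Q r : deg_le ((2 * b) %/ 3) P -> deg_le b Q ->
  (cubic P Q).[r] = 0 -> deg_le (b %/ 3) r.
Proof.
move=> degP degQ; rewrite horner_cubic => r0; rewrite /deg_le leqNgt; apply/negP => big.
have rn0 : r != 0 by rewrite -size_poly_gt0 (leq_trans _ big).
have r3E : r ^+ 3 = 3 *: P * r - 2 *: Q.
  by apply/eqP; rewrite -subr_eq0 -r0; apply/eqP; ring.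
have deg3 : deg_le (maxn ((2 * b) %/ 3 + (size r).-1) b) (3 *: P * r - 2 *: Q).
  have szZ (a : K) (p : {poly K}) n : deg_le n p -> deg_le n (a *: p).
    by apply: leq_trans; exact: size_scale_leq.
  apply: deg_leB.
    apply: (deg_leW (leq_maxl _ _)); apply: deg_leM; first exact: szZ.
    by rewrite /deg_le prednK// size_poly_gt0.
  by apply: (deg_leW (leq_maxr _ _)); exact: szZ.
have := deg3; rewrite /deg_le -r3E; have := size_exp r 3.
by move: (size (r ^+ 3)) (size r) big => m n; clear; lia.
Qed.

(* A root r satisfies (4 P - r^2) (P - r^2)^2 = - 4 y^(k+1) D, where only one of
   the two factors can vanish at 0. *)
Lemma cubic_no_root b k P Q D r :
  deg_le ((2 * b) %/ 3) P -> deg_le b Q -> (4 * b < 3 * k.+1)%N ->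
  Q ^+ 2 - P ^+ 3 = 'X^(k.+1) * D -> P.[0] != 0 -> D.[0] != 0 ->
  (cubic P Q).[r] != 0.
Proof.
move=> degP degQ bk QPD P0 D0; apply/eqP => r0.
have degr := deg_root_cubic degP degQ r0.
pose v := 4 * P - r * r; pose w := P - r * r.
have degr2 : deg_le ((2 * b) %/ 3) (r * r).
  by apply: deg_leW (deg_leM degr degr); clear; lia.
have degv : deg_le ((2 * b) %/ 3) v.
  by apply: deg_leB => //; exact: deg_leM (deg_le_nat _ 4) degP.
have degw : deg_le ((2 * b) %/ 3) w by exact: deg_leB.
have vw : v * w ^+ 2 = - 4 * D * 'X^(k.+1).
  have -> : - 4 * D * 'X^(k.+1) = - (2 * Q) ^+ 2 + 4 * P ^+ 3.
    by rewrite -mulrA [D * _]mulrC -QPD; ring.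
  have -> : 2 * Q = 3 * P * r - r ^+ 3.
    apply/eqP; rewrite -subr_eq0 -r0 horner_cubic !scaler_nat.
    by apply/eqP; ring.
  by rewrite /v /w; ring.
have vw0 : v * w ^+ 2 != 0.
  rewrite vw !mulf_neq0 ?oppr_eq0 ?expf_neq0 ?polyX_eq0//.
    by rewrite -polyC_natr polyC_eq0 pnatr_eq0.
  by apply: contraNneq D0 => ->; rewrite horner0.
move: (vw0); rewrite mulf_eq0 negb_or => /andP[v0 w20].
have Xvw : 'X^(k.+1) %| v * w ^+ 2 by rewrite vw dvdp_mull.
(* If v(0) is nonzero, y^(k+1) divides w^2, of degree at most 4 b / 3; otherwise it divides v, of
   degree at most 2 b / 3. The first case dictates the hypothesis [4 * b < 3 * k.+1]. *)
have [v00|v00] := eqVneq v.[0] 0; last first.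
  move: Xvw; rewrite dvdXn_mull// => /(dvdp_leq w20); rewrite size_polyXn.
  have := deg_leM degw degw; rewrite -expr2 /deg_le.
  by move: (size _) bk => n; clear; lia.
have w00 : w.[0] != 0.
  apply: contraNneq P0 => w00.
  have vwP : v - w = 3 *: P by rewrite /v /w scaler_nat; ring.
  have : 3 * P.[0] = 0 by rewrite -hornerZ -vwP hornerD hornerN v00 w00 subrr.
  by move/eqP; rewrite mulf_eq0 pnatr_eq0.
have w200 : (w ^+ 2).[0] != 0 by rewrite horner_exp expf_neq0.
move: Xvw; rewrite mulrC dvdXn_mull// => /(dvdp_leq v0); rewrite size_polyXn.
have := degv; rewrite /deg_le.
by move: (size v) bk => n; clear; lia.
Qed.

(** The leading coefficients of two factors multiply to 1, so both are units: a constant factor is a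
    unit, and a linear one has a root in K[y]. *)
Lemma monic_cubic_irreducible (F : {poly {poly K}}) :
  size F = 4%N -> lead_coef F = 1 -> (forall r, F.[r] != 0) -> irreducible_elt F.
Proof.
move=> sF lF noroot; have F0 : F != 0 by rewrite -size_poly_eq0 sF.
have const_unit (q : {poly {poly K}}) :
    size q = 1%N -> lead_coef q \is a GRing.unit -> q \is a GRing.unit.
  by rewrite lead_coefE => sq; rewrite sq /= => uq; rewrite poly_unitE sq uq.
have linear_root (q r : {poly {poly K}}) :
    size q = 2%N -> lead_coef q \is a GRing.unit -> F <> q * r.
  rewrite lead_coefE => sq; rewrite sq /= => uq FE.
  have := noroot (- q`_0 / q`_1); rewrite FE hornerM [q.[_]]horner_coef sq.
  rewrite !big_ord_recl big_ord0 addr0 -[X in _ + X]/(q`_1 * (- q`_0 / q`_1) ^+ 1).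
  by rewrite expr0 mulr1 expr1 mulNr mulrN [q`_1 * _]mulrC divrK// subrr mul0r eqxx.
split=> // [|q r FE]; first by rewrite poly_unitE sF.
have : lead_coef q * lead_coef r = 1 by rewrite -lead_coefM -FE.
move=> lqr; have uq : lead_coef q \is a GRing.unit.
  by apply/unitrPr; exists (lead_coef r).
have ur : lead_coef r \is a GRing.unit.
  by apply/unitrPr; exists (lead_coef q); rewrite mulrC.
move: F0; rewrite FE mulf_eq0 negb_or => /andP[q0 r0].
have sqr : (size q + size r = 5)%N.
  by have := size_mul q0 r0; rewrite -FE sF; case: (size q + size r)%N => [//|n] /= <-.
have q_gt0 : (0 < size q)%N by rewrite size_poly_gt0.
have r_gt0 : (0 < size r)%N by rewrite size_poly_gt0.
have [sq|sq|sq|sq] : [\/ size q = 1%N, size q = 2%N, size r = 1%N | size r = 2%N].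
  by move: (size q) (size r) sqr q_gt0 r_gt0 => [|[|[|m]]] [|[|[|n]]] //; do ?[by constructor]; clear; lia.
- by left; exact: const_unit.
- by case: (linear_root q r sq uq FE).
- by right; exact: const_unit.
- by case: (linear_root r q sq ur); rewrite mulrC.
Qed.

End CubicFacts.

(** * Explicit curves *)

Local Delimit Scope Z_scope with BZ.

(** * Polynomial arithmetic that evaluates by conversion *)

Section ListPolynomials.
Variables (A : Type) (zero : A) (add mul : A -> A -> A) (opp : A -> A).
Variables (R : comNzRingType) (f : A -> R).
Hypotheses (f0 : f zero = 0) (fD : {morph f : x y / add x y >-> x + y}).
Hypotheses (fN : {morph f : x / opp x >-> - x}).
Hypothesis fM : {morph f : x y / mul x y >-> x * y}.

Fixpoint list_add (s t : seq A) : seq A :=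
  match s, t with
  | [::], _ => t
  | _, [::] => s
  | x :: s', y :: t' => add x y :: list_add s' t'
  end.

Fixpoint list_mul (s t : seq A) : seq A :=
  if s is x :: s' then list_add (map (mul x) t) (zero :: list_mul s' t) else [::].

Definition list_discriminant (P Q : seq A) : seq A :=
  list_add (list_mul Q Q) (map opp (list_mul P (list_mul P P))).

Definition list_poly (s : seq A) : {poly R} := Poly (map f s).

Lemma list_poly_cons x s : list_poly (x :: s) = list_poly s * 'X + (f x)%:P.
Proof. by rewrite /list_poly /= cons_poly_def. Qed.

Lemma list_polyD s t : list_poly (list_add s t) = list_poly s + list_poly t.
Proof.
elim: s t => [|x s IH] [|y t] /=; rewrite ?list_poly_cons ?polyC0 ?add0r ?addr0//.
by rewrite IH fD polyCD; ring.
Qed.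

Lemma list_polyZ x s : list_poly (map (mul x) s) = f x *: list_poly s.
Proof.
elim: s => [|y s IH]; first by rewrite /list_poly /= polyC0 scaler0.
by rewrite /= !list_poly_cons IH fM -!mul_polyC polyCM; ring.
Qed.

Lemma list_polyN s : list_poly (map opp s) = - list_poly s.
Proof.
elim: s => [|y s IH]; first by rewrite /list_poly /= polyC0 oppr0.
by rewrite /= !list_poly_cons IH fN polyCN; ring.
Qed.

Lemma list_polyM s t : list_poly (list_mul s t) = list_poly s * list_poly t.
Proof.
elim: s => [|x s IH]; first by rewrite /list_poly /= polyC0 mul0r.
by rewrite /= list_polyD list_polyZ !list_poly_cons IH f0 -mul_polyC polyC0; ring.
Qed.

Lemma coef_list_poly s (i : nat) : (list_poly s)`_i = f (nth zero s i).
Proof.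
rewrite coef_Poly; have [lt|ge] := ltnP i (size s); first by rewrite (nth_map zero).
by rewrite !nth_default ?size_map// f0.
Qed.

Lemma list_discriminantP P Q (k : nat) : let s := list_discriminant P Q in
  (forall i : nat, (i <= k)%N -> f (nth zero s i) = 0) ->
  list_poly Q ^+ 2 - list_poly P ^+ 3 = 'X^(k.+1) * drop_poly k.+1 (list_poly s).
Proof.
move=> s s0; have sE : list_poly s = list_poly Q ^+ 2 - list_poly P ^+ 3.
  by rewrite list_polyD list_polyN !list_polyM; ring.
rewrite -sE -[LHS](poly_take_drop k.+1) mulrC [take_poly _ _](_ : _ = 0) ?add0r//.
apply/polyP => i; rewrite coef_take_poly coef0; case: ifP => // ik.
by rewrite coef_list_poly s0.
Qed.

Lemma size_list_poly s : (size (list_poly s) <= size s)%N.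
Proof. by rewrite -(size_map f s); exact: size_Poly. Qed.

End ListPolynomials.

Definition cusp_data (K : numFieldType) (b k : nat) : Prop :=
  exists P Q D : {poly K}, [/\ deg_le ((2 * b) %/ 3) P, deg_le b Q,
    Q ^+ 2 - P ^+ 3 = 'X^(k.+1) * D, P.[0] != 0 & D.[0] != 0].

(** Vanishing is tested in [A], where it computes; non-vanishing is required in [K], as [f] is not
    assumed injective. *)
Lemma cusp_data_of_lists (A : eqType) (zero : A) (add mul : A -> A -> A) (opp : A -> A)
    (K : numFieldType) (f : A -> K) (b k : nat) (P Q : seq A) :
  f zero = 0 -> {morph f : x y / add x y >-> x + y} ->
  {morph f : x / opp x >-> - x} -> {morph f : x y / mul x y >-> x * y} ->
  let s := list_discriminant zero add mul opp P Q in
  [&& size P <= ((2 * b) %/ 3).+1, size Q <= b.+1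
    & all (pred1 zero) (take k.+1 s)]%N ->
  f (nth zero P 0) != 0 -> f (nth zero s k.+1) != 0 ->
  cusp_data K b k.
Proof.
move=> f0 fD fN fM s /and3P[sP sQ /allP s0] P0 D0.
have sz (i : nat) : (i <= k)%N -> f (nth zero s i) = 0.
  move=> ik; have [lt|ge] := ltnP i (size s); last by rewrite nth_default.
  have /s0/eqP : nth zero (take k.+1 s) i \in take k.+1 s.
    by apply: mem_nth; rewrite size_take_min leq_min lt ltnS ik.
  by rewrite nth_take// => ->.
exists (list_poly f P), (list_poly f Q), (drop_poly k.+1 (list_poly f s)); split.
- exact: leq_trans (size_list_poly _ _) sP.
- exact: leq_trans (size_list_poly _ _) sQ.
- exact: list_discriminantP.
- by rewrite horner_coef0 (coef_list_poly f0).
- by rewrite horner_coef0 coef_drop_poly (coef_list_poly f0) add0n.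
Qed.

Section Examples.
Variable K : numClosedFieldType.

Definition Z_embed (z : Z) : K := (int_of_Z z)%:~R.

Lemma Z_embed0 : Z_embed 0%BZ = 0. Proof. by []. Qed.
Lemma Z_embedD : {morph Z_embed : x y / Z.add x y >-> x + y}.
Proof. by move=> x y; rewrite /Z_embed -intrD -rmorphD. Qed.
Lemma Z_embedN : {morph Z_embed : x / Z.opp x >-> - x}.
Proof. by move=> x; rewrite /Z_embed -intrN -rmorphN. Qed.
Lemma Z_embedM : {morph Z_embed : x y / Z.mul x y >-> x * y}.
Proof. by move=> x y; rewrite /Z_embed -intrM -rmorphM. Qed.
Lemma Z_embed_eq0 z : (Z_embed z == 0) = (z == 0%BZ).
Proof. by rewrite /Z_embed intr_eq0 -(inj_eq (can_inj int_of_ZK)). Qed.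

Lemma cusp_data_Z b k (P Q : seq Z) :
  let s := list_discriminant 0%BZ Z.add Z.mul Z.opp P Q in
  [&& size P <= ((2 * b) %/ 3).+1, size Q <= b.+1
    & all (pred1 0%BZ) (take k.+1 s)]%N ->
  nth 0%BZ P 0 != 0%BZ -> nth 0%BZ s k.+1 != 0%BZ -> cusp_data K b k.
Proof.
move=> s sz P0 D0.
apply: (cusp_data_of_lists Z_embed0 Z_embedD Z_embedN Z_embedM sz);
  by rewrite Z_embed_eq0.
Qed.

(* (a, b) stands for a + b s with s ^ 2 = -3 *)
Definition quad_add (x y : Z * Z) : Z * Z := (x.1 + y.1, x.2 + y.2)%BZ.
Definition quad_opp (x : Z * Z) : Z * Z := (- x.1, - x.2)%BZ.
Definition quad_mul (x y : Z * Z) : Z * Z :=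
  (x.1 * y.1 - 3 * (x.2 * y.2), x.1 * y.2 + x.2 * y.1)%BZ.

(** [w] is a certificate of non-vanishing: its product with the coefficient of y^(k+1) is the
    nonzero integer [n]. *)
Lemma cusp_data_quad b k (P Q : seq (Z * Z)) (w : Z * Z) (n : Z) :
  let s := list_discriminant (0, 0)%BZ quad_add quad_mul quad_opp P Q in
  [&& size P <= ((2 * b) %/ 3).+1, size Q <= b.+1
    & all (pred1 (0, 0)%BZ) (take k.+1 s)]%N ->
  nth (0, 0)%BZ P 0 = (1, 0)%BZ -> quad_mul (nth (0, 0)%BZ s k.+1) w = (n, 0%BZ) ->
  n != 0%BZ -> cusp_data K b k.
Proof.
move=> s sz P0 D0 n0; have sqr := sqrtCK (-3 : K); set r := sqrtC _ in sqr.
pose f (x : Z * Z) := Z_embed x.1 + Z_embed x.2 * r.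
have Z3 : Z_embed 3%BZ = 3 by [].
have fM : {morph f : x y / quad_mul x y >-> x * y}.
  move=> x y; rewrite /f /quad_mul; cbn [fst snd]; rewrite /Z.sub !(Z_embedD, Z_embedN, Z_embedM) Z3.
  (* Writing 3 as - r^2 turns the relation for r into a plain polynomial identity that [ring] can
     prove. *)
  have -> : (3 : K) = - r ^+ 2 by rewrite sqr opprK.
  by ring.
have f0 : f (0, 0)%BZ = 0 by rewrite /f /= Z_embed0 mul0r addr0.
apply: (cusp_data_of_lists f0 _ _ fM sz).
- by move=> x y; rewrite /f /= !Z_embedD; ring.
- by move=> x; rewrite /f /= !Z_embedN; ring.
- by rewrite P0 /f /= Z_embed0 mul0r addr0 Z_embed_eq0.
- apply: contraNneq n0 => fD0; rewrite -Z_embed_eq0.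
  have := fM (nth (0, 0)%BZ s k.+1) w; rewrite D0 fD0 mul0r /f /= Z_embed0 mul0r addr0.
  by move=> ->.
Qed.

(* (a, b, c) stands for a + b t + c t ^ 2 with t ^ 3 = 3 t - 4 *)
Definition cub_add (x y : Z * Z * Z) : Z * Z * Z :=
  (x.1.1 + y.1.1, x.1.2 + y.1.2, x.2 + y.2)%BZ.
Definition cub_opp (x : Z * Z * Z) : Z * Z * Z := (- x.1.1, - x.1.2, - x.2)%BZ.
(** [m3] and [m4] are the coefficients of t^3 and t^4, reduced by t^3 = 3 t - 4 and t^4 = 3 t^2 - 4
    t. *)
Definition cub_mul (x y : Z * Z * Z) : Z * Z * Z :=
  let m3 := (x.1.2 * y.2 + x.2 * y.1.2)%BZ in let m4 := (x.2 * y.2)%BZ in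
  (x.1.1 * y.1.1 - 4 * m3, x.1.1 * y.1.2 + x.1.2 * y.1.1 + 3 * m3 - 4 * m4,
   x.1.1 * y.2 + x.1.2 * y.1.2 + x.2 * y.1.1 + 3 * m4)%BZ.

(** Any root t in [K] will do: the certificate [w] replaces an argument that t^3 - 3 t + 4 is
    irreducible. *)
Lemma cusp_data_cub b k (P Q : seq (Z * Z * Z)) (w : Z * Z * Z) (n : Z) :
  let s := list_discriminant (0, 0, 0)%BZ cub_add cub_mul cub_opp P Q in
  [&& size P <= ((2 * b) %/ 3).+1, size Q <= b.+1
    & all (pred1 (0, 0, 0)%BZ) (take k.+1 s)]%N ->
  nth (0, 0, 0)%BZ P 0 = (1, 0, 0)%BZ ->
  cub_mul (nth (0, 0, 0)%BZ s k.+1) w = (n, 0, 0)%BZ ->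
  n != 0%BZ -> cusp_data K b k.
Proof.
move=> s sz P0 D0 n0.
have [t tE] := @solve_monicpoly K 3 (nth 0 [:: -4; 3; 0]) isT.
have {}tE : t ^+ 3 = 3 * t - 4.
  by rewrite tE !big_ord_recl big_ord0/=; ring.
pose f (x : Z * Z * Z) := Z_embed x.1.1 + Z_embed x.1.2 * t + Z_embed x.2 * t ^+ 2.
have Z3 : Z_embed 3%BZ = 3 by [].
have Z4 : Z_embed 4%BZ = 4 by [].
have fM : {morph f : x y / cub_mul x y >-> x * y}.
  move=> x y; rewrite /f /cub_mul; cbn [fst snd]; rewrite /Z.sub !(Z_embedD, Z_embedN, Z_embedM) Z3 Z4.
  have -> : (4 : K) = 3 * t - t ^+ 3 by rewrite tE; ring.
  by ring.
have f0 : f (0, 0, 0)%BZ = 0 by rewrite /f /= Z_embed0 !mul0r !addr0.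
apply: (cusp_data_of_lists f0 _ _ fM sz).
- by move=> x y; rewrite /f /= !Z_embedD; ring.
- by move=> x; rewrite /f /= !Z_embedN; ring.
- by rewrite P0 /f /= Z_embed0 !mul0r !addr0 Z_embed_eq0.
- apply: contraNneq n0 => fD0; rewrite -Z_embed_eq0.
  have := fM (nth (0, 0, 0)%BZ s k.+1) w.
  by rewrite D0 fD0 mul0r /f /= Z_embed0 !mul0r !addr0 => ->.
Qed.

(* In each example Q is the Taylor polynomial of degree b of P^(3/2), and P was
   found by solving the equations that the coefficients of P^(3/2) in degrees
   b + 1, ..., k vanish. *)
Lemma cusp_data3 : cusp_data K 3 3.
Proof.
exact: (@cusp_data_Z 3 3
  [:: 1; 0; 4]%BZ
  [:: 1; 0; 6]%BZ).
Qed.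

Lemma cusp_data4 : cusp_data K 4 5.
Proof.
exact: (@cusp_data_Z 4 5
  [:: 1; 0; 4]%BZ
  [:: 1; 0; 6; 0; 6]%BZ).
Qed.

Lemma cusp_data5 : cusp_data K 5 7.
Proof.
exact: (@cusp_data_Z 5 7
  [:: 1; 12; 60; 96]%BZ
  [:: 1; 18; 144; 576; 1080; 432]%BZ).
Qed.

Lemma cusp_data6 : cusp_data K 6 8.
Proof.
exact: (@cusp_data_Z 6 8
  [:: 1; 0; 0; 8]%BZ
  [:: 1; 0; 0; 12; 0; 0; 24]%BZ).
Qed.

Lemma cusp_data7 : cusp_data K 7 10.
Proof.
exact: (@cusp_data_Z 7 10
  [:: 1; 12; 44; 0; -176]%BZ
  [:: 1; 18; 120; 288; -240; -1728; -224; 1728]%BZ).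
Qed.

Lemma cusp_data8 : cusp_data K 8 12.
Proof.
exact: (@cusp_data_quad 8 12
  [:: (1, 0); (4, -16); (-278, -68); (-1260, 648); (945, 3024); (5508,
    1620)]%BZ
  [:: (1, 0); (6, -24); (-699, -150); (-4600, 3384); (22545, 24030);
    (196020, -1782); (253449, -244944); (-258066, -345546); (-183708,
    -26244)]%BZ
    (-2, 1)%BZ 238085568%BZ).
Qed.

Lemma cusp_data9 : cusp_data K 9 13.
Proof.
exact: (@cusp_data_Z 9 13
  [:: 1; 0; 16; 0; 160; 0; 384]%BZ
  [:: 1; 0; 24; 0; 336; 0; 2240; 0; 8064]%BZ).
Qed.

Lemma cusp_data10 : cusp_data K 10 15.
Proof.
exact: (@cusp_data_Z 10 15
  [:: 1; 0; 36; 0; 540; 0; 2592]%BZ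
  [:: 1; 0; 54; 0; 1296; 0; 15552; 0; 87480; 0; 104976]%BZ).
Qed.

Lemma cusp_data11 : cusp_data K 11 17.
Proof.
exact: (@cusp_data_cub 11 17
  [:: (1, 0, 0); (20, 8, -6); (348, -76, -25); (1120, 448, -784); (8688,
    -6304, 200); (-10944, 13888, -11888); (37184, -55328, 21896); (-51200,
    54656, -23456)]%BZ
  [:: (1, 0, 0); (30, 12, -9); (816, -156, -63); (5184, 1572, -2877);
    (64224, -34992, -3204); (2880, 113328, -151236); (1160448, -1374384,
    329700); (-4314240, 4388112, -2409444); (11556864, -16083936, 7379064);
    (-29883392, 34158432, -14804328); (32954880, -39861024, 18656568);
    (-8944896, 10878432, -4930200)]%BZ
    (-1404132199276367, -368622558484260, 123353063186613)%BZ 55345972428302530379776%BZ).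
Qed.

Lemma cusp_data12 : cusp_data K 12 18.
Proof.
exact: (@cusp_data_Z 12 18
  [:: 1; 0; 84; 176; 2366; 13536; 26884; 218864; 268777]%BZ
  [:: 1; 0; 126; 264; 6195; 31392; 163956; 1260528; 3531639; 19770400;
    62912622; 94024776; 291742453]%BZ).
Qed.

End Examples.

(** * Values of N(3, b) and irreducible curves *)

Lemma cusp_data_N_is (R : realType) (b k : nat) : (2 < b)%N -> (0 < k)%N ->
  (5 * b < 3 * k + 7)%N -> cusp_data R[i] b k -> N_is R[i] 3 b k.
Proof.
move=> b2 k0 bk [P [Q [D [degP degQ QPD P0 D0]]]]; split.
  exists (cubic P Q); first exact: cubic_bidegree.
  exists (Q.[0] / P.[0], 0).
  exact: type_A_cubic (@complex_abs_series_cvg R) k0 QPD P0 D0.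
move=> l [F Fb [s Fl]]; have := type_A_bound b2 Fb Fl.
(* [5 * b < 3 * k + 7] says that k + 1 would already violate the upper bound. *)
by move: bk; clear; lia.
Qed.

(** The inequality 4 b < 3 (k + 1) fails for b = k = 3, where x = 1 is a root of the cubic given by
    the data of [cusp_data3]. *)
Lemma cusp_data_irreducible (R : realType) (b k : nat) : (0 < k)%N ->
  (4 * b < 3 * k.+1)%N -> cusp_data R[i] b k ->
  exists F : {poly {poly R[i]}}, [/\ irreducible_elt F, has_bidegree 3 b F
    & exists s : R[i] * R[i], type_A F s k].
Proof.
move=> k0 bk [P [Q [D [degP degQ QPD P0 D0]]]]; exists (cubic P Q); split.
- apply: monic_cubic_irreducible; rewrite ?size_cubic ?lead_coef_cubic// => r.
  exact: (cubic_no_root r degP degQ bk QPD P0 D0).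
- exact: cubic_bidegree.
- exists (Q.[0] / P.[0], 0).
  exact: type_A_cubic (@complex_abs_series_cvg R) k0 QPD P0 D0.
Qed.

Theorem theorem1 (R : realType) :
  [/\ N_is R[i] 3 3 3, N_is R[i] 3 4 5, N_is R[i] 3 5 7, N_is R[i] 3 6 8
    & N_is R[i] 3 7 10] /\
  [/\ N_is R[i] 3 8 12, N_is R[i] 3 9 13, N_is R[i] 3 10 15,
      N_is R[i] 3 11 17 & N_is R[i] 3 12 18] /\
  (forall b : nat, (4 <= b <= 12)%N ->
     exists n : nat, N_is R[i] 3 b n /\
       exists F : {poly {poly R[i]}},
         [/\ irreducible_elt F, has_bidegree 3 b F
           & exists s : R[i] * R[i], type_A F s n]).
Proof.
split; [|split].
- by split; apply: cusp_data_N_is => //; [exact: cusp_data3|exact: cusp_data4|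
    exact: cusp_data5|exact: cusp_data6|exact: cusp_data7].
- by split; apply: cusp_data_N_is => //; [exact: cusp_data8|exact: cusp_data9|
    exact: cusp_data10|exact: cusp_data11|exact: cusp_data12].
have large (b n : nat) : (2 < b)%N -> (0 < n)%N -> (5 * b < 3 * n + 7)%N ->
    (4 * b < 3 * n.+1)%N -> cusp_data R[i] b n ->
    exists n : nat, N_is R[i] 3 b n /\ exists F : {poly {poly R[i]}},
      [/\ irreducible_elt F, has_bidegree 3 b F & exists s : R[i] * R[i], type_A F s n].
  move=> b2 n0 bn bn' data; exists n; split; first exact: cusp_data_N_is.
  exact: cusp_data_irreducible.
move=> b b412; have : b \in iota 4 9 by rewrite mem_iota.
case/predU1P=> [->|]; first exact: large (cusp_data4 _).
case/predU1P=> [->|]; first exact: large (cusp_data5 _).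
case/predU1P=> [->|]; first exact: large (cusp_data6 _).
case/predU1P=> [->|]; first exact: large (cusp_data7 _).
case/predU1P=> [->|]; first exact: large (cusp_data8 _).
case/predU1P=> [->|]; first exact: large (cusp_data9 _).
case/predU1P=> [->|]; first exact: large (cusp_data10 _).
case/predU1P=> [->|]; first exact: large (cusp_data11 _).
by case/predU1P=> [->|//]; exact: large (cusp_data12 _).
Qed.
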